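(* Consider the linear regression model $z(t)=\phi^\top(t)\theta+\varepsilon(t)$, $t\ge0$, where $\phi:[0,\infty)\to\mathbb{R}^n$ is smooth and uniformly bounded, $\theta\in\mathbb{R}^n$ is a constant unknown parameter, $z:[0,\infty)\to\mathbb{R}$ is continuous, and the measurement noise $\varepsilon$ is bounded. Let $0\le q\le n$ and suppose that $\phi$ displays partial persistent excitation (PPE) with lack of persistency of order $q$, with PE subspace $\mathrm{Im}\,N_d$. Let $\alpha,\beta,\gamma,\delta,\kappa>0$ and $\hat\theta_0\in\mathbb{R}^n$ be arbitrary, and let $\hat\theta(t)$ be the estimate generated by the parameter learning algorithm described in the context. For $t\ge 0$ let $\theta^*(t)$ be the least squares solution, i.e. the minimizer over $v\in\mathbb{R}^n$ of the cost $$J_t(v)=\frac12\int_0^t\mathrm{e}^{-\beta(t-\tau)}\left(z(\tau)-v^\top\phi(\tau)\right)^2\mathrm{d}\tau+\frac{\alpha}{2}\mathrm{e}^{-\beta t}\left\|v-\hat\theta_0\right\|^2 .$$ Then there exist two positive reals $\rho_a,\rho_b$ such that $$\left\|\hat\theta(t)-\theta^*(t)\right\|\le\rho_a\mathrm{e}^{-\rho_b t}\qquad\text{for all }t\ge0,$$ and the decay rate $\rho_b$ can be made arbitrarily fast by increasing $\gamma$. In particular, in the noise-free case $\varepsilon(t)\equiv0$, there exists a positive real $\rho_c$ such that $$\left\|N_d^\top\left(\hat\theta(t)-\theta\right)\right\|\le\rho_c\,\mathrm{e}^{-(\beta/2)t}\qquad\text{for all }t\ge0.$$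
   Context: Notation: $\|\cdot\|$ is the Euclidean norm of vectors and the induced 2-norm of matrices; inequalities between symmetric matrices are in the positive semidefinite order. PPE: $\phi$ displays partial persistent excitation with lack of persistency of order $q$ ($0\le q\le n$) if there exist positive reals $T,k_a,k_b$ and a real orthogonal projection matrix $\varPhi\in\mathbb{R}^{n\times n}$ (i.e. $\varPhi^2=\varPhi=\varPhi^\top$) of rank $n-q$ such that $$k_a\varPhi\le\int_t^{t+T}\phi(\tau)\phi^\top(\tau)\,\mathrm{d}\tau\le k_b\varPhi\qquad\forall t\ge 0.$$ $N_d\in\mathbb{R}^{n\times(n-q)}$ is a matrix whose columns form an orthonormal basis of $\mathrm{Im}\,\varPhi$ (so $N_dN_d^\top=\varPhi$); $\mathrm{Im}\,N_d$ is called the PE subspace. PE-subspace algorithm (parameters $\beta,\gamma,\delta$): with $Q(0)=P(0)=0_{n\times n}$, $$\dot Q(t)=-\beta Q(t)+\phi(t)\phi^\top(t),$$ $$\dot P(t)=-\gamma P(t)+\gamma I-\gamma^2\int_0^t\mathrm{e}^{-\gamma(t-\tau)}\bar N_u(\tau)\bar N_u^\top(\tau)\,\mathrm{d}\tau,$$ $$\bar N_u(\tau)=\hat N_u(k\delta)\quad\text{for } k\delta\le\tau<(k+1)\delta,\ k=0,1,2,\dots,$$ where $\hat N_u(k\delta)$ is a matrix whose columns form an orthonormal basis of $\mathrm{Ker}\,Q(k\delta)$ (so $\hat N_u(k\delta)\hat N_u^\top(k\delta)$ is the orthogonal projection onto $\mathrm{Ker}\,Q(k\delta)$, equal to $0$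 if the kernel is trivial). Parameter learning algorithm (parameters $\alpha,\beta,\kappa>0$, prior estimate $\hat\theta_0$), using $Q,P,\dot P$ above (time arguments omitted): $$\dot{\hat\theta}_d=-\varOmega\left(R\hat\theta_d-zP\phi-\dot P\varphi\right),\quad \hat\theta_d(0)=0,$$ $$\hat\theta_u=(I-P)\hat\theta_0,\qquad \hat\theta=\hat\theta_d+\hat\theta_u,$$ $$\dot\varphi=-\beta\varphi+z\phi,\quad\varphi(0)=\alpha\hat\theta_0,$$ $$\dot\varOmega=\beta\varOmega-\varOmega R\varOmega,\quad\varOmega(0)=\kappa^{-1}I,$$ $$R=P\phi\phi^\top P+\kappa\beta(I-P)+\dot PQP+PQ\dot P+\left(\alpha\mathrm{e}^{-\beta t}-\kappa\right)\dot P.$$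
   Formalization: The noise-free bound with rate β/2 is stated only for γ > β/2; for γ ≤ β/2 it fails, e.g. n=1, q=0, φ≡1, θ=0, ε≡0, prior estimate 1, where the error is at least I−P, of order t·e^{-γt}. *)

(* Defs.v *)
From HB Require Import structures.
From mathcomp Require Import all_boot all_order all_algebra.
From mathcomp Require Import all_classical all_reals all_analysis.
Set Implicit Arguments.
Unset Strict Implicit.
Unset Printing Implicit Defensive.
Import Order.TTheory GRing.Theory Num.Theory.
Import numFieldNormedType.Exports.
Local Open Scope classical_set_scope.
Local Open Scope ring_scope.

(* Signals live on [0, +oo): they are total functions R -> V whose values at
   negative times are never used. *)

(* Derivative relative to [0, +oo): two-sided at t > 0, right derivative at 0. *)
Definition is_derivative {R : realType} {V : normedModType R}
    (f : R -> V) (t : R) (df : V) : Prop :=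
  h^-1 *: (f (t + h) - f t) @[h --> within [set h | 0 <= t + h] (0^')] --> df.

Definition smooth {R : realType} {V : normedModType R} (f : R -> V) : Prop :=
  exists D : nat -> R -> V,
    (forall t, 0 <= t -> D 0%N t = f t) /\
    (forall k t, 0 <= t -> is_derivative (D k) t (D k.+1 t)).

(* The library norm on matrices is the max norm, hence this definition. *)
Definition enorm {R : realType} {n : nat} (v : 'cV[R]_n) : R :=
  Num.sqrt (\sum_i v i 0 ^+ 2).

(* Only meant for symmetric A and B. *)
Definition loewner_le {R : realType} {n : nat} (A B : 'M[R]_n) : Prop :=
  forall x : 'cV[R]_n, 0 <= (x^T *m (B - A) *m x) 0 0.

Definition mx_integral {R : realType} {m n : nat} (a b : R)
    (F : R -> 'M[R]_(m, n)) : 'M[R]_(m, n) :=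
  \matrix_(i, j) \int[lebesgue_measure]_(s in `[a, b]) F s i j.

Definition orthonormal_basis {R : realType} {n m : nat}
    (N : 'M[R]_(n, m)) (V : set 'cV[R]_n) : Prop :=
  N^T *m N = 1%:M /\ range (fun w : 'cV[R]_m => N *m w) = V.

Definition image_mx {R : realType} {n : nat} (A : 'M[R]_n) : set 'cV[R]_n :=
  range (fun w : 'cV[R]_n => A *m w).

Definition kernel_mx {R : realType} {n : nat} (A : 'M[R]_n) : set 'cV[R]_n :=
  [set v | A *m v = 0].

Definition orthogonal_projection {R : realType} {n : nat}
    (A : 'M[R]_n) : Prop :=
  A *m A = A /\ A^T = A.

(* Partial persistent excitation of phi, with lack of persistency of order q,
   witnessed by the projection Phi onto the PE subspace. *)
Definition PPE_with {R : realType} {n : nat} (phi : R -> 'cV[R]_n) (q : nat)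
    (Phi : 'M[R]_n) : Prop :=
  [/\ orthogonal_projection Phi,
      \rank Phi = (n - q)%N
    & exists T ka kb : R,
      [/\ 0 < T, 0 < ka, 0 < kb
        & forall t, 0 <= t ->
          let G := mx_integral t (t + T) (fun s => phi s *m (phi s)^T) in
          loewner_le (ka *: Phi) G /\ loewner_le G (kb *: Phi)]].

(* Nu k plays the role of \hat N_u(k delta); its number of columns d k is the
   dimension of Ker Q(k delta).  For s >= 0, Num.truncn (s / delta) is the k
   such that k delta <= s < (k + 1) delta, so that the integrand below is
   \bar N_u(s) \bar N_u(s)^T. *)
Record PE_subspace_algorithm {R : realType} {n : nat} (phi : R -> 'cV[R]_n)
    (beta gamma delta : R) (d : nat -> nat) (Nu : forall k, 'M[R]_(n, d k))
    (Q P dP : R -> 'M[R]_n) : Prop := {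
  PEalg_Q0 : Q 0 = 0;
  PEalg_Q : forall t, 0 <= t ->
    is_derivative Q t (- beta *: Q t + phi t *m (phi t)^T);
  PEalg_Nu : forall k, orthonormal_basis (Nu k) (kernel_mx (Q (k%:R * delta)));
  PEalg_P0 : P 0 = 0;
  PEalg_P : forall t, 0 <= t -> is_derivative P t (dP t);
  PEalg_dP : forall t, 0 <= t ->
    dP t = - gamma *: P t + gamma%:M
      - gamma ^+ 2 *: mx_integral 0 t (fun s =>
          let k := Num.truncn (s / delta) in
          expR (- gamma * (t - s)) *: (Nu k *m (Nu k)^T))
}.

Definition learning_R {R : realType} {n : nat} (alpha beta kappa t : R)
    (phi : 'cV[R]_n) (Q P dP : 'M[R]_n) : 'M[R]_n :=
  P *m phi *m phi^T *m P + (kappa * beta) *: (1%:M - P)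
  + dP *m Q *m P + P *m Q *m dP
  + (alpha * expR (- beta * t) - kappa) *: dP.

Record learning_algorithm {R : realType} {n : nat} (phi : R -> 'cV[R]_n)
    (z : R -> R) (alpha beta kappa : R) (theta0 : 'cV[R]_n)
    (Q P dP Omega : R -> 'M[R]_n) (varphi theta_d theta_hat : R -> 'cV[R]_n)
    : Prop := {
  learn_theta_d0 : theta_d 0 = 0;
  learn_theta_d : forall t, 0 <= t ->
    is_derivative theta_d t
      (- (Omega t *m
          (learning_R alpha beta kappa t (phi t) (Q t) (P t) (dP t)
             *m theta_d t
           - z t *: (P t *m phi t) - dP t *m varphi t)));
  learn_theta_hat : forall t, 0 <= t ->
    theta_hat t = theta_d t + (1%:M - P t) *m theta0;
  learn_varphi0 : varphi 0 = alpha *: theta0;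
  learn_varphi : forall t, 0 <= t ->
    is_derivative varphi t (- beta *: varphi t + z t *: phi t);
  learn_Omega0 : Omega 0 = kappa^-1%:M;
  learn_Omega : forall t, 0 <= t ->
    is_derivative Omega t
      (beta *: Omega t
       - Omega t
           *m learning_R alpha beta kappa t (phi t) (Q t) (P t) (dP t)
           *m Omega t)
}.

Definition generated_estimate {R : realType} {n : nat} (phi : R -> 'cV[R]_n)
    (z : R -> R) (alpha beta gamma delta kappa : R) (theta0 : 'cV[R]_n)
    (theta_hat : R -> 'cV[R]_n) : Prop :=
  exists (d : nat -> nat) (Nu : forall k, 'M[R]_(n, d k))
         (Q P dP Omega : R -> 'M[R]_n) (varphi theta_d : R -> 'cV[R]_n),
    PE_subspace_algorithm phi beta gamma delta Nu Q P dP /\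
    learning_algorithm phi z alpha beta kappa theta0 Q P dP Omega
      varphi theta_d theta_hat.

Definition ls_cost {R : realType} {n : nat} (phi : R -> 'cV[R]_n) (z : R -> R)
    (alpha beta : R) (theta0 : 'cV[R]_n) (t : R) (v : 'cV[R]_n) : R :=
  2^-1 * (\int[lebesgue_measure]_(s in `[0, t])
            (expR (- beta * (t - s)) * (z s - (v^T *m phi s) 0 0) ^+ 2))
  + alpha / 2 * expR (- beta * t) * enorm (v - theta0) ^+ 2.

Definition is_minimizer {R : realType} {T : Type} (J : T -> R) (x : T) : Prop :=
  forall y, J x <= J y.

(* Main.v *)
Require Import Defs.
From HB Require Import structures.
From mathcomp Require Import all_boot all_order all_algebra.
From mathcomp Require Import all_classical all_reals all_analysis.
From mathcomp Require Import measurable_realfun ring lra.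
Set Implicit Arguments.
Unset Strict Implicit.
Unset Printing Implicit Defensive.
Import Order.TTheory GRing.Theory Num.Theory.
Import numFieldNormedType.Exports.
Local Open Scope classical_set_scope.
Local Open Scope ring_scope.

(* Put a(t) = alpha e^(-beta t).  The cost J_t is a quadratic polynomial whose
   coefficients solve the filter equations of Q and varphi, so its minimizer
   satisfies (Q + a) theta* = varphi.  On the other side, the matrix
     W = P Q P + kappa (I - P) + a P
   satisfies W' = -beta W + R, so that Omega is its inverse, and W theta_d and
   P varphi solve the same linear equation; hence W theta_d = P varphi.
   Persistent excitation gives Phi Q = Q = Q Phi and Q >= c Phi after time T;
   from then on Ker Q = Ker Phi, the kernel projections fed to the P-filter are
   I - Phi, and e^(gamma t) (P - Phi) grows at most linearly.  Thus
   E = P - Phi decays at every rate below gamma.  Replacing P by Phi turns W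
   into W_inf = Q + kappa (I - Phi) + a Phi, which is uniformly coercive, and
     W (theta_d - Phi theta* ) = E varphi - (W - W_inf) Phi theta*
   shows that theta_d - Phi theta* decays like E.  Since theta* - theta0 has no
   component in Ker Phi, theta_hat - theta* equals
   theta_d - Phi theta* - E theta0.  Without noise, the same coercive matrix
   maps Phi (theta* - theta) to a Phi (theta0 - theta). *)

(** * Calculus of signals on the half-line *)

Section ScalarCalculus.
Context {R : realType}.
Implicit Types (f g df dg : R -> R) (t a b c : R).

Definition cont0 f := {within `[0, +oo[, continuous f}.

(* Differential equations on [0, +oo) are used in this form only: nothing is
   asked of df at 0, where continuity of f replaces the one-sided derivative. *)
Definition sderiv f df :=
  cont0 f /\ forall t, 0 < t -> is_derive t 1 f (df t).

Lemma cont0P f :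
  cont0 f <-> forall t, 0 <= t -> f @ within `[0, +oo[ (nbhs t) --> f t.
Proof.
rewrite /cont0; split=> [/subspace_continuousP h t t0|h].
  by apply: h; rewrite /= in_itv/= t0.
by apply/subspace_continuousP => t /=; rewrite in_itv/= andbT => /h.
Qed.

(** Near [t] the difference quotient lies within 1 of [d], so [f] is locally Lipschitz at [t] with
    constant [|d| + 1]. At [t = 0] only nonnegative [s] are compared. *)
Lemma is_derivative_cont f t d : 0 <= t ->
  is_derivative f t d -> f @ within `[0, +oo[ (nbhs t) --> f t.
Proof.
move=> t0 /cvgrPdist_lt /(_ 1 ltr01).
rewrite near_withinE /dnbhs near_withinE => -/nbhs_ballP[r /= r0 hr].
apply/cvgrPdist_lt => e e0; rewrite near_withinE.
have c0 : 0 < `|d| + 1 by rewrite ltr_wpDl.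
near=> s => /=; rewrite in_itv/= andbT => s0.
have [->|st] := eqVneq s t; first by rewrite subrr normr0.
have hst : s - t != 0 by rewrite subr_eq0.
have : ball 0 r (s - t).
  rewrite -ball_normE /= sub0r normrN distrC.
  by near: s; apply: nbhsx_ballx.
move=> /hr /= /(_ hst); rewrite addrC subrK => /(_ s0) h.
have -> : f t - f s = - ((s - t) * ((s - t)^-1 *: (f s - f t))).
  by rewrite /GRing.scale /= mulVKf// opprB.
rewrite normrN normrM.
have : `|(s - t)^-1 *: (f s - f t)| <= `|d| + 1.
  set q := _ *: _ in h *.
  have -> : q = d - (d - q) by rewrite opprB addrC subrK.
  by rewrite (le_trans (ler_normB _ _))// lerD2l ltW.
move=> /(ler_wpM2l (normr_ge0 (s - t))) /le_lt_trans; apply.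
rewrite -ltr_pdivlMr// distrC.
have : ball t (e / (`|d| + 1)) s by near: s; apply: nbhsx_ballx; rewrite divr_gt0.
by rewrite -ball_normE.
Unshelve. all: by end_near.
Qed.

(** For positive [t] the constraint [0 <= t + h] holds for all small [h], so the restricted limit is
    a two-sided one. *)
Lemma is_derivative_derive f t d : 0 < t ->
  is_derivative f t d -> is_derive t 1 f d.
Proof.
move=> t0 h.
suff H : h^-1 *: (f (h *: 1 + t) - f t) @[h --> 0^'] --> d.
  split; first by apply/cvg_ex; exists d.
  exact: (cvg_lim _ H).
have tn : \forall h \near 0^', 0 <= t + h.
  apply: nbhs_dnbhs; near=> h0.
  have : ball 0 t h0 by near: h0; apply: nbhsx_ballx.
  by rewrite -ball_normE /= sub0r normrN ltr_norml => /andP[? _]; lra.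
apply/cvgrPdist_lt => e e0; move/cvgrPdist_lt : h => /(_ e e0).
rewrite near_withinE => h.
near=> x; rewrite /GRing.scale /= mulr1 (addrC _ t).
by apply: (near h x) => //; near: x.
Unshelve. all: by end_near.
Qed.

Lemma is_derivative_sderiv f df :
  (forall t, 0 <= t -> is_derivative f t (df t)) -> sderiv f df.
Proof.
move=> h; split; last by move=> t t0; apply: is_derivative_derive => //; exact/h/ltW.
by apply/cont0P => t t0; apply: is_derivative_cont t0 (h t t0).
Qed.

Lemma cont0_cst c : cont0 (fun=> c).
Proof. by apply/cont0P => t _; exact: cvg_cst. Qed.

Lemma cont0D f g : cont0 f -> cont0 g -> cont0 (fun t => f t + g t).
Proof.
by move=> /cont0P cf /cont0P cg; apply/cont0P => t t0; apply: cvgD; [exact: cf|exact: cg].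
Qed.

Lemma cont0N f : cont0 f -> cont0 (fun t => - f t).
Proof. by move=> /cont0P cf; apply/cont0P => t t0; apply: cvgN; exact: cf. Qed.

Lemma cont0M f g : cont0 f -> cont0 g -> cont0 (fun t => f t * g t).
Proof.
by move=> /cont0P cf /cont0P cg; apply/cont0P => t t0; apply: cvgM; [exact: cf|exact: cg].
Qed.

Lemma cont0_expR c : cont0 (fun t => expR (c * t)).
Proof.
apply: continuous_subspaceT => t.
apply: (@continuous_comp _ _ _ ( *%R c) (@expR R)); last exact: continuous_expR.
exact: mulrl_continuous.
Qed.

Lemma cont0_sum (I : Type) (r : seq I) (F : I -> R -> R) :
  (forall i, cont0 (F i)) -> cont0 (fun t => \sum_(i <- r) F i t).
Proof.
move=> h; elim: r => [|i r ih].
  by under eq_fun do rewrite big_nil; exact: cont0_cst.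
by under eq_fun do rewrite big_cons; apply: cont0D.
Qed.

Lemma sderiv_cst c : sderiv (fun=> c) (fun=> 0).
Proof. by split=> [|t t0]; [exact: cont0_cst|exact: is_derive_cst]. Qed.

Lemma sderiv_eq f df dg : (forall t, 0 < t -> df t = dg t) ->
  sderiv f df -> sderiv f dg.
Proof. by move=> e [cf h]; split=> // t t0; rewrite -e//; exact: h. Qed.

Lemma sderivD f g df dg : sderiv f df -> sderiv g dg ->
  sderiv (fun t => f t + g t) (fun t => df t + dg t).
Proof.
move=> [cf hf] [cg hg]; split=> [|t t0]; first exact: cont0D.
by have := hf t t0; have := hg t t0 => ? ?; exact: is_deriveD.
Qed.

Lemma sderivN f df : sderiv f df -> sderiv (fun t => - f t) (fun t => - df t).
Proof.
move=> [cf hf]; split=> [|t t0]; first exact: cont0N.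
by have := hf t t0 => ?; exact: is_deriveN.
Qed.

Lemma sderivM f g df dg : sderiv f df -> sderiv g dg ->
  sderiv (fun t => f t * g t) (fun t => df t * g t + f t * dg t).
Proof.
move=> [cf hf] [cg hg]; split=> [|t t0]; first exact: cont0M.
have -> : df t * g t + f t * dg t = f t *: dg t + g t *: df t.
  by rewrite /GRing.scale /= addrC [df t * _]mulrC.
exact: is_deriveM (hf t t0) (hg t t0).
Qed.

Lemma sderivZ c f df : sderiv f df ->
  sderiv (fun t => c * f t) (fun t => c * df t).
Proof.
by move=> /(sderivM (sderiv_cst c)); apply: sderiv_eq => t t0; rewrite mul0r add0r.
Qed.

Lemma sderiv_expR c : sderiv (fun t => expR (c * t)) (fun t => c * expR (c * t)).
Proof.
split=> [|t t0]; first exact: cont0_expR.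
rewrite mulrC; apply: (is_derive1_comp (f := @expR R) (g := *%R c)).
apply: is_derive_eq (is_deriveZ c (is_derive_id t (1 : R))) _.
by rewrite /GRing.scale /= mulr1.
Qed.

Lemma sderiv_id : sderiv id (fun=> 1).
Proof.
split=> [|t t0]; last exact: is_derive_id.
by apply/cont0P => t t0; exact: cvg_within.
Qed.

Lemma sderiv_sum (I : Type) (r : seq I) (F dF : I -> R -> R) :
  (forall i, sderiv (F i) (dF i)) ->
  sderiv (fun t => \sum_(i <- r) F i t) (fun t => \sum_(i <- r) dF i t).
Proof.
move=> h; elim: r => [|i r ih].
  have -> : (fun t => \sum_(i <- [::]) F i t) = fun=> 0.
    by apply/funext => t; rewrite big_nil.
  by apply: sderiv_eq (sderiv_cst 0) => t _; rewrite big_nil.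
have -> : (fun t => \sum_(j <- i :: r) F j t) =
          fun t => F i t + \sum_(j <- r) F j t.
  by apply/funext => t; rewrite big_cons.
by apply: sderiv_eq (sderivD (h i) ih) => t _; rewrite big_cons.
Qed.

Lemma cont0_itv f a b : 0 <= a -> cont0 f -> {within `[a, b], continuous f}.
Proof.
move=> a0; apply: continuous_subspaceW => x /=; rewrite !in_itv/= andbT.
by move=> /andP[ax _]; exact: le_trans ax.
Qed.

Lemma sderiv_le0 f df a b : 0 <= a -> a <= b -> sderiv f df ->
  (forall t, a < t < b -> df t <= 0) -> f b <= f a.
Proof.
move=> a0 ab [cf hf] df0.
apply: (@ler0_derive1_nincr _ f a b) => //.
- by move=> x; rewrite in_itv/= => /andP[ax _]; have := hf x (le_lt_trans a0 ax); case.
- move=> x; rewrite in_itv/= => xab; rewrite derive1E.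
  have /andP[ax _] := xab.
  by have := hf x (le_lt_trans a0 ax) => -[_ ->]; exact: df0.
- exact: cont0_itv.
Qed.

Lemma sderiv_ge0 f df a b : 0 <= a -> a <= b -> sderiv f df ->
  (forall t, a < t < b -> 0 <= df t) -> f a <= f b.
Proof.
move=> a0 ab /sderivN h df0; rewrite -lerN2.
by apply: sderiv_le0 a0 ab h _ => t /df0; rewrite oppr_le0.
Qed.

Lemma cont0_bounded f b : cont0 f -> exists2 C, 0 <= C & forall t, 0 <= t <= b -> `|f t| <= C.
Proof.
move=> cf; have cfb := @cont0_itv f 0 b (lexx 0) cf.
have /compact_bounded [M [Mr hM]] := continuous_compact cfb (@segment_compact R 0 b).
exists (`|M| + 1); first by rewrite addr_ge0.
move=> t t0b; apply: hM; first by rewrite (le_lt_trans (ler_norm M))// ltrDl.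
by exists t.
Qed.

Lemma cont0_integrable f a b : 0 <= a -> cont0 f ->
  (@lebesgue_measure R).-integrable `[a, b] (EFin \o f).
Proof.
move=> a0 cf; apply: continuous_compact_integrable; first exact: segment_compact.
exact: cont0_itv.
Qed.

Lemma sderiv_integral f df a b : 0 <= a -> a <= b -> sderiv f df -> cont0 df ->
  \int[lebesgue_measure]_(s in `[a, b]) df s = f b - f a.
Proof.
move=> a0; rewrite le_eqVlt => /predU1P[-> _ _|ab [cf hf] cdf].
  by rewrite set_itv1 Rintegral_set1 subrr.
rewrite /Rintegral (@continuous_FTC2 R df f a b)//.
- exact: cont0_itv.
- have cW := cont0_itv (b := b) a0 cf.
  have [_ ? ?] := (continuous_within_itvP f ab).1 cW.
  split=> //.
  by move=> x; rewrite in_itv/= => /andP[ax _]; have := hf x (le_lt_trans a0 ax); case.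
- move=> x; rewrite in_itv/= => /andP[ax _]; rewrite derive1E.
  by have := hf x (le_lt_trans a0 ax) => -[_ ->].
Qed.

End ScalarCalculus.

(** * Matrix-valued signals and their growth *)

Section MatrixCalculus.
Context {R : realType}.
Implicit Types (a r s : R -> R) (D : set R).

Definition mx_deriv m n (F dF : R -> 'M[R]_(m, n)) :=
  forall i j, sderiv (fun t => F t i j) (fun t => dF t i j).

Lemma is_derivative_mx_deriv m n (F dF : R -> 'M[R]_(m, n)) :
  (forall t, 0 <= t -> is_derivative F t (dF t)) -> mx_deriv F dF.
Proof.
move=> h i j; apply: is_derivative_sderiv => t t0; rewrite /is_derivative.
have := cvg_comp _ _ (h t t0) (@coord_continuous _ _ _ i j (dF t)).
by apply: cvg_trans; apply: near_eq_cvg; near=> x; rewrite /= !mxE.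
Unshelve. all: by end_near.
Qed.

Lemma mx_deriv_eq m n (F dF dG : R -> 'M[R]_(m, n)) :
  (forall t, 0 < t -> dF t = dG t) -> mx_deriv F dF -> mx_deriv F dG.
Proof. by move=> e h i j; apply: sderiv_eq (h i j) => t t0; rewrite e. Qed.

Lemma mx_deriv_cst m n (A : 'M[R]_(m, n)) : mx_deriv (fun=> A) (fun=> 0).
Proof. by move=> i j; apply: sderiv_eq (sderiv_cst _) => t _; rewrite mxE. Qed.

Lemma mx_derivD m n (F G dF dG : R -> 'M[R]_(m, n)) :
  mx_deriv F dF -> mx_deriv G dG ->
  mx_deriv (fun t => F t + G t) (fun t => dF t + dG t).
Proof.
move=> hF hG i j; under eq_fun do rewrite mxE.
by apply: sderiv_eq (sderivD (hF i j) (hG i j)) => t _; rewrite mxE.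
Qed.

Lemma mx_derivN m n (F dF : R -> 'M[R]_(m, n)) :
  mx_deriv F dF -> mx_deriv (fun t => - F t) (fun t => - dF t).
Proof.
move=> hF i j; under eq_fun do rewrite mxE.
by apply: sderiv_eq (sderivN (hF i j)) => t _; rewrite mxE.
Qed.

Lemma mx_derivB m n (F G dF dG : R -> 'M[R]_(m, n)) :
  mx_deriv F dF -> mx_deriv G dG ->
  mx_deriv (fun t => F t - G t) (fun t => dF t - dG t).
Proof. by move=> hF hG; apply: mx_derivD => //; exact: mx_derivN. Qed.

Lemma mx_derivM m n p (F dF : R -> 'M[R]_(m, n)) (G dG : R -> 'M[R]_(n, p)) :
  mx_deriv F dF -> mx_deriv G dG ->
  mx_deriv (fun t => F t *m G t) (fun t => dF t *m G t + F t *m dG t).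
Proof.
move=> hF hG i j; under eq_fun do rewrite mxE.
apply: sderiv_eq (sderiv_sum _ (fun k => sderivM (hF i k) (hG k j))) => t _.
by rewrite !mxE big_split.
Qed.

Lemma mx_derivZ m n a (da : R -> R) (F dF : R -> 'M[R]_(m, n)) :
  sderiv a da -> mx_deriv F dF ->
  mx_deriv (fun t => a t *: F t) (fun t => da t *: F t + a t *: dF t).
Proof.
move=> ha hF i j; under eq_fun do rewrite mxE.
by apply: sderiv_eq (sderivM ha (hF i j)) => t _; rewrite !mxE.
Qed.

Lemma mx_derivZc m n c (F dF : R -> 'M[R]_(m, n)) :
  mx_deriv F dF -> mx_deriv (fun t => c *: F t) (fun t => c *: dF t).
Proof.
move=> hF; apply: mx_deriv_eq (mx_derivZ (sderiv_cst c) hF) => t _.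
by rewrite scale0r add0r.
Qed.

Lemma mx_derivT m n (F dF : R -> 'M[R]_(m, n)) :
  mx_deriv F dF -> mx_deriv (fun t => (F t)^T) (fun t => (dF t)^T).
Proof.
move=> hF i j; under eq_fun do rewrite mxE.
by apply: sderiv_eq (hF j i) => t _; rewrite mxE.
Qed.

(** An entrywise big-O with one constant on all of [D]: the rate 1 expresses boundedness, an
    exponential rate expresses decay. Dimension factors from matrix products are absorbed in the
    constant. *)
Definition mxO D r m n (F : R -> 'M[R]_(m, n)) :=
  exists2 C, 0 <= C & forall t, D t -> forall i j, `|F t i j| <= C * r t.

Local Notation mxO1 D := (mxO D (fun=> 1)).

Lemma mxO_eq D r m n (F G : R -> 'M[R]_(m, n)) :
  (forall t, D t -> F t = G t) -> mxO D r F -> mxO D r G.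
Proof. by move=> e [C C0 h]; exists C => // t Dt i j; rewrite -e//; exact: h. Qed.

Lemma mxO_sub D D' r m n (F : R -> 'M[R]_(m, n)) :
  D' `<=` D -> mxO D r F -> mxO D' r F.
Proof. by move=> e [C C0 h]; exists C => // t /e Dt i j; exact: h. Qed.

Lemma mxO_rate D r s c m n (F : R -> 'M[R]_(m, n)) : 0 <= c ->
  (forall t, D t -> r t <= c * s t) -> mxO D r F -> mxO D s F.
Proof.
move=> c0 rs [C C0 h]; exists (C * c) => [|t Dt i j]; first exact: mulr_ge0.
by rewrite (le_trans (h t Dt i j))// -mulrA ler_wpM2l// rs.
Qed.

Lemma mxO_cst D m n (A : 'M[R]_(m, n)) : mxO1 D (fun=> A).
Proof.
exists (\sum_i \sum_j `|A i j|) => [|t _ i j].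
  by apply: sumr_ge0 => i _; exact: sumr_ge0.
rewrite mulr1 (bigD1 i)//= (bigD1 j)//= -addrA lerDl addr_ge0//.
  exact: sumr_ge0.
by apply: sumr_ge0 => k _; exact: sumr_ge0.
Qed.

Lemma mxOD D r m n (F G : R -> 'M[R]_(m, n)) :
  mxO D r F -> mxO D r G -> mxO D r (fun t => F t + G t).
Proof.
move=> [C C0 h] [C' C'0 h']; exists (C + C') => [|t Dt i j]; first exact: addr_ge0.
by rewrite mxE (le_trans (ler_normD _ _))// mulrDl lerD ?h ?h'.
Qed.

Lemma mxON D r m n (F : R -> 'M[R]_(m, n)) :
  mxO D r F -> mxO D r (fun t => - F t).
Proof. by move=> [C C0 h]; exists C => // t Dt i j; rewrite mxE normrN h. Qed.

Lemma mxOB D r m n (F G : R -> 'M[R]_(m, n)) :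
  mxO D r F -> mxO D r G -> mxO D r (fun t => F t - G t).
Proof. by move=> hF hG; apply: mxOD => //; exact: mxON. Qed.

Lemma mxOZ D r s m n a c (F : R -> 'M[R]_(m, n)) : 0 <= c ->
  (forall t, D t -> `|a t| <= c * s t) -> mxO D r F ->
  mxO D (fun t => s t * r t) (fun t => a t *: F t).
Proof.
move=> c0 ha [C C0 h]; exists (c * C) => [|t Dt i j]; first exact: mulr_ge0.
by rewrite mxE normrM mulrACA ler_pM// ?ha ?h.
Qed.

Lemma mxOM D r s m n p (F : R -> 'M[R]_(m, n)) (G : R -> 'M[R]_(n, p)) :
  mxO D r F -> mxO D s G -> mxO D (fun t => r t * s t) (fun t => F t *m G t).
Proof.
move=> [C C0 h] [C' C'0 h']; exists (n%:R * (C * C')) => [|t Dt i j].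
  by rewrite !mulr_ge0.
rewrite mxE (le_trans (ler_norm_sum _ _ _))//.
rewrite -mulrA mulrACA mulr_natl -[n in leRHS]card_ord -sumr_const.
by apply: ler_sum => k _; rewrite normrM ler_pM// ?h ?h'.
Qed.

Lemma mxO1Z D r m n a c (F : R -> 'M[R]_(m, n)) :
  (forall t, D t -> `|a t| <= c) -> mxO D r F -> mxO D r (fun t => a t *: F t).
Proof.
(* A point of [D] is what makes [c] nonnegative, hence the separate case of empty [D]. *)
move=> ha hF; have [->|/set0P[t0 Dt0]] := eqVneq D set0; first by exists 0.
have c0 : 0 <= c := le_trans (normr_ge0 _) (ha _ Dt0).
have : mxO D (fun t => 1 * r t) (fun t => a t *: F t).
  by apply: (mxOZ c0) => // t Dt; rewrite mulr1 ha.
by apply: (@mxO_rate D _ _ 1) => // t _; rewrite !mul1r.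
Qed.

Lemma mxOMl D r m n p (F : R -> 'M[R]_(m, n)) (G : R -> 'M[R]_(n, p)) :
  mxO1 D F -> mxO D r G -> mxO D r (fun t => F t *m G t).
Proof.
by move=> /mxOM /[apply]; apply: (@mxO_rate D _ _ 1) => // t _; rewrite !mul1r.
Qed.

Lemma mxOMr D r m n p (F : R -> 'M[R]_(m, n)) (G : R -> 'M[R]_(n, p)) :
  mxO D r F -> mxO1 D G -> mxO D r (fun t => F t *m G t).
Proof.
by move=> /mxOM /[apply]; apply: (@mxO_rate D _ _ 1) => // t _; rewrite mulr1 mul1r.
Qed.

Lemma mxO_entry D r m n (F : R -> 'M[R]_(m, n)) :
  (forall i j, exists2 C, 0 <= C & forall t, D t -> `|F t i j| <= C * r t) ->
  (forall t, D t -> 0 <= r t) -> mxO D r F.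
Proof.
move=> h r0.
pose C i j := xget 0 [set C | 0 <= C /\ forall t, D t -> `|F t i j| <= C * r t].
have hC i j : 0 <= C i j /\ forall t, D t -> `|F t i j| <= C i j * r t.
  have [c c0 hc] := h i j.
  exact: (@xgetI _ 0 [set C | 0 <= C /\ forall t, D t -> `|F t i j| <= C * r t] c).
exists (\sum_i \sum_j C i j) => [|t Dt i j].
  by apply: sumr_ge0 => i _; apply: sumr_ge0 => j _; case: (hC i j).
rewrite (le_trans ((hC i j).2 t Dt))// ler_wpM2r ?r0//.
rewrite (bigD1 i)//= (bigD1 j)//= -addrA lerDl addr_ge0//.
  by apply: sumr_ge0 => k _; case: (hC i k).
by apply: sumr_ge0 => k _; apply: sumr_ge0 => l _; case: (hC k l).
Qed.

Lemma mx_cont_bounded m n (F : R -> 'M[R]_(m, n)) b :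
  (forall i j, cont0 (fun t => F t i j)) -> mxO1 [set t | 0 <= t <= b] F.
Proof.
move=> cF; apply: mxO_entry => // i j.
have [C C0 h] := cont0_bounded b (cF i j).
by exists C => // t t0; rewrite mulr1 h.
Qed.

Lemma mx_deriv_bounded m n (F dF : R -> 'M[R]_(m, n)) b :
  mx_deriv F dF -> mxO1 [set t | 0 <= t <= b] F.
Proof. by move=> h; apply: mx_cont_bounded => i j; case: (h i j). Qed.

(** Gronwall's argument: the squared Frobenius norm [E] satisfies [E' <= c E], so [e^(-c t) E] is
    nonincreasing from 0. Every identity between signals below is reduced to this uniqueness. *)
Lemma linear_ode_unique m n (A : R -> 'M[R]_m) (X : R -> 'M[R]_(m, n)) :
  X 0 = 0 -> mx_deriv X (fun t => A t *m X t) ->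
  (forall b, mxO1 [set t | 0 <= t <= b] A) -> forall t, 0 <= t -> X t = 0.
Proof.
move=> X0 hX hA b b0; have [C C0 hC] := hA b.
pose E t := \sum_i \sum_j (X t i j * X t i j).
pose dE t := \sum_i \sum_j ((A t *m X t) i j * X t i j + X t i j * (A t *m X t) i j).
(* Bounding each product by [2 |x_ij x_kj| <= x_kj^2 + x_ij^2] and summing over [i, j, k] gives two
   sums of squares, each equal to [m E]. *)
pose c := C * m%:R *+ 2.
have hE : sderiv E dE.
  by apply: sderiv_sum => i; apply: sderiv_sum => j; exact: sderivM.
have dEle t : 0 <= t <= b -> dE t <= c * E t.
  move=> t0b; rewrite /dE.
  apply: (@le_trans _ _ (\sum_i \sum_j \sum_k C * (X t k j * X t k j + X t i j * X t i j))).
    apply: ler_sum => i _; apply: ler_sum => j _.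
    rewrite mulrC -mulr2n mxE mulr_sumr -sumrMnl; apply: ler_sum => k _.
    have : X t i j * (A t i k * X t k j) <= C * (`|X t i j| * `|X t k j|).
      rewrite (le_trans (ler_norm _))// !normrM mulrCA ler_wpM2r ?mulr_ge0//.
      by have := hC t t0b i k; rewrite mulr1.
    have : `|X t i j| * `|X t k j| *+ 2 <= X t k j * X t k j + X t i j * X t i j.
      rewrite -!expr2 -(real_normK (num_real (X t k j))) -(real_normK (num_real (X t i j))).
      by rewrite -subr_ge0 (_ : _ - _ = (`|X t k j| - `|X t i j|) ^+ 2) ?sqr_ge0//; ring.
    move=> /(ler_wpM2l C0); rewrite mulrnAr => h1 h2.
    by apply: le_trans h1; rewrite lerMn2r h2 orbT.
  have -> : \sum_(i < m) \sum_(j < n) \sum_(k < m)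
      C * (X t k j * X t k j + X t i j * X t i j) =
    \sum_(i < m) \sum_(j < n) \sum_(k < m) C * (X t k j * X t k j) +
    \sum_(i < m) \sum_(j < n) \sum_(k < m) C * (X t i j * X t i j).
    rewrite -big_split; apply: eq_bigr => i _; rewrite -big_split; apply: eq_bigr => j _.
    by rewrite -big_split; apply: eq_bigr => k _; rewrite mulrDr.
  have -> : \sum_(i < m) \sum_(j < n) \sum_(k < m) C * (X t i j * X t i j) = C * m%:R * E t.
    rewrite mulr_sumr; apply: eq_bigr => i _; rewrite mulr_sumr; apply: eq_bigr => j _.
    by rewrite sumr_const card_ord -(mulr_natr (C * _)); ring.
  have -> : \sum_(i < m) \sum_(j < n) \sum_(k < m) C * (X t k j * X t k j) = C * m%:R * E t.
    rewrite sumr_const card_ord -[C * _ * _]mulrA mulr_natl mulrnAr; congr (_ *+ m).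
    rewrite /E exchange_big mulr_sumr; apply: eq_bigr => j _.
    by rewrite mulr_sumr.
  by rewrite /c mulrnAl -mulr2n.
have hEe : sderiv (fun t => expR (- c * t) * E t)
   (fun t => (- c * expR (- c * t)) * E t + expR (- c * t) * dE t).
  by apply: sderivM => //; exact: sderiv_expR.
have Eb : expR (- c * b) * E b <= expR (- c * 0) * E 0.
  apply: sderiv_le0 (lexx 0) b0 hEe _ => t /andP[t0 tb].
  rewrite [X in X * E t]mulrC -mulrA -mulrDr pmulr_rle0 ?expR_gt0//.
  by rewrite mulNr addrC subr_le0 dEle// !ltW.
have E00 : E 0 = 0.
  by rewrite /E X0 big1// => i _; rewrite big1// => j _; rewrite mxE mulr0.
have Xge0 i j : 0 <= X b i j * X b i j by rewrite -expr2 sqr_ge0.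
move: Eb; rewrite E00 mulr0 pmulr_rle0 ?expR_gt0// => Eb.
have /psumr_eq0P Eb0 : E b = 0.
  by apply/eqP; rewrite eq_le Eb/=; apply: sumr_ge0 => i _; exact: sumr_ge0.
apply/matrixP => i j; rewrite mxE.
have /psumr_eq0P := Eb0 (fun i _ => sumr_ge0 _ (fun j _ => Xge0 i j)) i isT.
move=> /(_ (fun j _ => Xge0 i j) j isT) /eqP.
by rewrite mulf_eq0 orbb => /eqP.
Qed.

End MatrixCalculus.
Local Notation mxO1 D := (mxO D (fun=> 1)).

(** * Euclidean estimates and first-order filters *)

Section EuclideanNorm.
Context {R : realType} {n : nat}.
Implicit Types (v x y : 'cV[R]_n) (A : 'M[R]_n) (c C : R).

Lemma normr_le_enorm v i : `|v i 0| <= enorm v.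
Proof.
rewrite -sqrtr_sqr ler_wsqrtr// (bigD1 i)//= lerDl.
by apply: sumr_ge0 => j _; exact: sqr_ge0.
Qed.

Lemma enorm_le v C : 0 <= C -> (forall i, `|v i 0| <= C) -> enorm v <= n%:R * C.
Proof.
move=> C0 h; have nC0 : 0 <= n%:R * C by rewrite mulr_ge0.
rewrite -(ger0_norm nC0) -sqrtr_sqr ler_wsqrtr//.
apply: (@le_trans _ _ (\sum_(i < n) C ^+ 2)).
  by apply: ler_sum => i _; rewrite -(real_normK (num_real (v i 0))) lerXn2r ?nnegrE// h.
rewrite sumr_const card_ord -[leLHS]mulr_natl exprMn ler_wpM2r ?sqr_ge0//.
by rewrite -natrX ler_nat -{1}(expn1 n); case: n => // k; rewrite leq_pexp2l.
Qed.

Lemma dotmx_ge0 x : 0 <= (x^T *m x) 0 0.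
Proof. by rewrite mxE sumr_ge0// => i _; rewrite mxE -expr2 sqr_ge0. Qed.

Lemma dotmx_le0 x : (x^T *m x) 0 0 <= 0 -> x = 0.
Proof.
have x0 (i : 'I_n) : true -> 0 <= x^T 0 i * x i 0 by rewrite mxE -expr2 sqr_ge0.
move=> h; have /(psumr_eq0P x0) h0 : \sum_i x^T 0 i * x i 0 = 0.
  by apply/eqP; rewrite eq_le sumr_ge0// andbT; move: h; rewrite mxE.
apply/matrixP => i j; rewrite ord1 mxE; apply/eqP.
by have /eqP := h0 i isT; rewrite mxE mulf_eq0 orbb.
Qed.

(** Coercivity gives [c |x|^2 <= x . y]; Young's inequality absorbs half of the left side and leaves
    [|x|^2 <= n C^2 / c^2]. The estimate [n <= n^2] then avoids a square root. *)
Lemma coercive_bound A x y c C : 0 < c ->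
  c * (x^T *m x) 0 0 <= (x^T *m A *m x) 0 0 -> A *m x = y ->
  (forall i, `|y i 0| <= C) -> forall i, `|x i 0| <= n%:R / c * C.
Proof.
move=> c0 h Axy yC i; have C0 : 0 <= C := le_trans (normr_ge0 _) (yC i).
have nC0 : 0 <= n%:R / c * C by rewrite mulr_ge0// divr_ge0// ltW.
rewrite -ler_sqr ?nnegrE//.
rewrite (real_normK (num_real _)).
have sumx : (x^T *m x) 0 0 = \sum_j x j 0 ^+ 2.
  by rewrite mxE; apply: eq_bigr => j _; rewrite mxE expr2.
have : c * (x^T *m x) 0 0 <= \sum_j x j 0 * y j 0.
  apply: le_trans h _; rewrite -mulmxA Axy mxE.
  by apply: ler_sum => j _; rewrite mxE.
rewrite sumx => hc.
have hle : \sum_j x j 0 * y j 0 <= \sum_j (c / 2 * x j 0 ^+ 2 + C ^+ 2 / (2 * c)).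
  apply: ler_sum => j _.
  have yj2 : y j 0 ^+ 2 <= C ^+ 2.
    by rewrite -(real_normK (num_real (y j 0))) lerXn2r ?nnegrE.
  have : 0 <= (c * x j 0 - y j 0) ^+ 2 / (2 * c).
    by rewrite divr_ge0 ?sqr_ge0// mulr_ge0// ltW.
  have -> : (c * x j 0 - y j 0) ^+ 2 / (2 * c) =
     c / 2 * x j 0 ^+ 2 - x j 0 * y j 0 + y j 0 ^+ 2 / (2 * c).
    by field; rewrite gt_eqF.
  have : y j 0 ^+ 2 / (2 * c) <= C ^+ 2 / (2 * c).
    by rewrite ler_wpM2r// invr_ge0 mulr_ge0// ltW.
  lra.
have {hc hle} := le_trans hc hle.
rewrite big_split/= -mulr_sumr sumr_const card_ord -mulr_natl => hs.
have : \sum_j x j 0 ^+ 2 <= n%:R * (C ^+ 2 / c ^+ 2).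
  rewrite -(ler_pM2l c0).
  have -> : c * (n%:R * (C ^+ 2 / c ^+ 2)) = 2 * (n%:R * (C ^+ 2 / (2 * c))).
    by field; rewrite gt_eqF.
  lra.
move=> hs2; apply: le_trans (le_trans _ hs2) _.
  by rewrite (bigD1 i)//= lerDl sumr_ge0// => j _; rewrite sqr_ge0.
rewrite !exprMn exprVn -mulrA [_ ^-2 * _]mulrC ler_wpM2r//.
  by rewrite mulr_ge0 ?sqr_ge0// invr_ge0 sqr_ge0.
rewrite -natrX ler_nat -{1}(expn1 n).
by case: n i => [[]//|k] _; rewrite leq_pexp2l.
Qed.

Lemma quadform_le A x C : (forall i j, `|A i j| <= C) ->
  `|(x^T *m A *m x) 0 0| <= n%:R * C * (x^T *m x) 0 0.
Proof.
move=> hA.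
have -> : (x^T *m A *m x) 0 0 = \sum_j \sum_i (x i 0 * A i j * x j 0).
  rewrite mxE; apply: eq_bigr => j _; rewrite mxE mulr_suml.
  by apply: eq_bigr => i _; rewrite mxE.
have sumx : (x^T *m x) 0 0 = \sum_j x j 0 ^+ 2.
  by rewrite mxE; apply: eq_bigr => j _; rewrite mxE expr2.
rewrite (le_trans (ler_norm_sum _ _ _))//.
apply: (@le_trans _ _ (\sum_(j < n) \sum_(i < n) (C / 2 * x i 0 ^+ 2 + C / 2 * x j 0 ^+ 2))).
  apply: ler_sum => j _; rewrite (le_trans (ler_norm_sum _ _ _))//.
  apply: ler_sum => i _; rewrite !normrM.
  have C0 : 0 <= C := le_trans (normr_ge0 _) (hA i j).
  rewrite mulrAC.
  apply: (@le_trans _ _ (`|x i 0| * `|x j 0| * C)).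
    by rewrite ler_wpM2l// mulr_ge0.
  rewrite -(real_normK (num_real (x i 0))) -(real_normK (num_real (x j 0))).
  have : 0 <= C / 2 * (`|x i 0| - `|x j 0|) ^+ 2.
    by rewrite mulr_ge0 ?sqr_ge0// divr_ge0.
  nra.
have -> : \sum_(j < n) \sum_(i < n) (C / 2 * x i 0 ^+ 2 + C / 2 * x j 0 ^+ 2) =
    \sum_(j < n) \sum_(i < n) (C / 2 * x i 0 ^+ 2) +
    \sum_(j < n) \sum_(i < n) (C / 2 * x j 0 ^+ 2).
  by rewrite -big_split; apply: eq_bigr => j _; rewrite -big_split.
rewrite [X in _ + X]exchange_big /= sumr_const card_ord -mulr_sumr -sumx.
by rewrite -mulr_natl le_eqVlt; apply/orP; left; apply/eqP; field.
Qed.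

End EuclideanNorm.

Section Filters.
Context {R : realType}.

Lemma filter_exp m n c (Y U : R -> 'M[R]_(m, n)) :
  mx_deriv Y (fun t => - c *: Y t + U t) ->
  mx_deriv (fun t => expR (c * t) *: Y t) (fun t => expR (c * t) *: U t).
Proof.
move=> dY; apply: mx_deriv_eq (mx_derivZ (sderiv_expR c) dY) => t _.
by rewrite scalerDr !scalerA addrA -scalerDl mulrN mulrC subrr scale0r add0r.
Qed.

(** The usual way below to prove [Y = Z]: exhibit both as outputs of one filter with the same input
    and initial value. *)
Lemma filter_unique m n c (Y Z U : R -> 'M[R]_(m, n)) : Y 0 = Z 0 ->
  mx_deriv Y (fun t => c *: Y t + U t) -> mx_deriv Z (fun t => c *: Z t + U t) ->
  forall t, 0 <= t -> Y t = Z t.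
Proof.
move=> YZ0 dY dZ t t0; apply/subr0_eq.
apply: (@linear_ode_unique _ _ _ (fun=> c%:M) (fun t => Y t - Z t)) => //.
- by rewrite YZ0 subrr.
- apply: mx_deriv_eq (mx_derivB dY dZ) => s _.
  by rewrite mul_scalar_mx scalerBr opprD addrACA subrr addr0.
- by move=> b; exact: mxO_cst.
Qed.

(** Compare each entry of [e^(c t) Y] with the barrier [(C / c) e^(c t)]: their sum is nondecreasing
    and their difference nonincreasing. *)
Lemma filter_bounded m n c (Y U : R -> 'M[R]_(m, n)) : 0 < c ->
  mx_deriv Y (fun t => - c *: Y t + U t) ->
  mxO1 [set t | 0 <= t] U -> mxO1 [set t | 0 <= t] Y.
Proof.
move=> c0 dY [C C0 hC]; apply: mxO_entry => // i j.
have dX : sderiv (fun t => expR (c * t) * Y t i j) (fun t => expR (c * t) * U t i j).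
  have h := filter_exp dY i j; move: h; under eq_fun do rewrite mxE.
  by apply: sderiv_eq => t _; rewrite mxE.
have dE : sderiv (fun t => C / c * expR (c * t)) (fun t => C * expR (c * t)).
  apply: sderiv_eq (sderivZ (C / c) (sderiv_expR c)) => t _.
  by rewrite mulrA divfK// gt_eqF.
have UC t : 0 <= t -> `|U t i j| <= C.
  by move=> t0; have := hC t t0 i j; rewrite mulr1.
have Cc0 : 0 <= C / c by rewrite divr_ge0// ltW.
exists (`|Y 0 i j| + C / c) => [|t t0]; first by rewrite addr_ge0.
rewrite mulr1 -(ler_pM2l (expR_gt0 (c * t))).
have E1 : 1 <= expR (c * t) by rewrite -expR0 ler_expR mulr_ge0// ltW.
have EY : `|Y 0 i j| <= expR (c * t) * `|Y 0 i j| by rewrite ler_peMl.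
rewrite -[X in X * `|_|]ger0_norm ?expR_ge0// -normrM ler_norml; apply/andP; split.
- have : expR (c * 0) * Y 0 i j + C / c * expR (c * 0) <=
         expR (c * t) * Y t i j + C / c * expR (c * t).
    apply: sderiv_ge0 (lexx 0) t0 (sderivD dX dE) _ => s /andP[s0 _].
    rewrite [C * _]mulrC -mulrDr mulr_ge0 ?expR_ge0//.
    by have := UC s (ltW s0); rewrite ler_norml => /andP[]; lra.
  rewrite mulr0 expR0 mul1r mulr1 mulrDr.
  have := ler_norm (- Y 0 i j); rewrite normrN; lra.
- have : expR (c * t) * Y t i j - C / c * expR (c * t) <=
         expR (c * 0) * Y 0 i j - C / c * expR (c * 0).
    apply: sderiv_le0 (lexx 0) t0 (sderivD dX (sderivN dE)) _ => s /andP[s0 _].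
    rewrite [C * _]mulrC -mulrBr mulr_ge0_le0 ?expR_ge0//.
    by have := UC s (ltW s0); rewrite ler_norml => /andP[]; lra.
  rewrite mulr0 expR0 mul1r mulr1 mulrDr.
  have := ler_norm (Y 0 i j); lra.
Qed.

Lemma Rintegral_sum (I : Type) (r : seq I) (F : I -> R -> R) a b : 0 <= a ->
  (forall i, cont0 (F i)) ->
  \int[lebesgue_measure]_(s in `[a, b]) (\sum_(i <- r) F i s) =
  \sum_(i <- r) \int[lebesgue_measure]_(s in `[a, b]) F i s.
Proof.
move=> a0 cF; elim: r => [|i r ih].
  rewrite big_nil -[RHS](Rintegral_set0 lebesgue_measure (fun=> 0)).
  have -> : (fun s => \sum_(i <- [::]) F i s) = fun=> 0.
    by apply/funext => s; rewrite big_nil.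
  by rewrite !Rintegral_cst// !mul0r.
have -> : (fun s => \sum_(j <- i :: r) F j s) =
          fun s => F i s + \sum_(j <- r) F j s.
  by apply/funext => s; rewrite big_cons.
rewrite RintegralD ?big_cons ?ih//; first exact: cont0_integrable.
by apply: cont0_integrable => //; exact: cont0_sum.
Qed.

Lemma mx_integral_quadform n (F : R -> 'M[R]_n) (x : 'cV[R]_n) a b : 0 <= a ->
  (forall i j, cont0 (fun s => F s i j)) ->
  (x^T *m mx_integral a b F *m x) 0 0 =
  \int[lebesgue_measure]_(s in `[a, b]) (x^T *m F s *m x) 0 0.
Proof.
move=> a0 cF.
have E (A : 'M[R]_n) : (x^T *m A *m x) 0 0 = \sum_j \sum_i (x i 0 * x j 0 * A i j).
  rewrite mxE; apply: eq_bigr => j _; rewrite mxE mulr_suml.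
  by apply: eq_bigr => i _; rewrite mxE mulrAC.
rewrite E; under eq_Rintegral do rewrite E.
have cE i j : cont0 (fun s => x i 0 * x j 0 * F s i j).
  by apply: cont0M => //; exact: cont0_cst.
rewrite Rintegral_sum//; last by move=> j; exact: cont0_sum.
apply: eq_bigr => j _; rewrite Rintegral_sum//; apply: eq_bigr => i _.
by rewrite RintegralZl ?mxE//; exact: cont0_integrable.
Qed.

End Filters.

(** * The information matrix under persistent excitation *)

Lemma mulmx_ext (R : realType) (n m : nat) (A B : 'M[R]_(n, m)) :
  (forall v : 'cV[R]_m, A *m v = B *m v) -> A = B.
Proof.
move=> h; apply/matrixP => i j; have := h (delta_mx j 0).
by rewrite -!colE => /matrixP/(_ i 0); rewrite mxE [RHS]mxE.
Qed.


Lemma quadformZ (R : realType) n (x : 'cV[R]_n) c (A : 'M[R]_n) :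
  (x^T *m (c *: A) *m x) 0 0 = c * (x^T *m A *m x) 0 0.
Proof. by rewrite -scalemxAr -scalemxAl mxE. Qed.

Lemma quadformD (R : realType) n (x : 'cV[R]_n) (A B : 'M[R]_n) :
  (x^T *m (A + B) *m x) 0 0 = (x^T *m A *m x) 0 0 + (x^T *m B *m x) 0 0.
Proof. by rewrite mulmxDr mulmxDl mxE. Qed.

Lemma loewner_quadform (R : realType) n (A B : 'M[R]_n) (x : 'cV[R]_n) :
  loewner_le A B -> (x^T *m A *m x) 0 0 <= (x^T *m B *m x) 0 0.
Proof. by move=> /(_ x); rewrite mulmxBr mulmxBl mxE [X in _ + X]mxE subr_ge0. Qed.

Lemma proj_quadform (R : realType) n (x : 'cV[R]_n) (Phi : 'M[R]_n) :
  orthogonal_projection Phi ->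
  (x^T *m Phi *m x) 0 0 = ((Phi *m x)^T *m (Phi *m x)) 0 0.
Proof.
by move=> [PP Ps]; rewrite trmx_mul Ps mulmxA -[_ *m Phi *m Phi]mulmxA PP.
Qed.

Section InformationMatrix.
Context {R : realType} {n : nat} (phi : R -> 'cV[R]_n) (beta : R) (Q : R -> 'M[R]_n).
Implicit Types (a b t : R).
Hypothesis beta_gt0 : 0 < beta.
Hypothesis phi_cont : forall i j, cont0 (fun t => phi t i j).
Hypothesis Q0 : Q 0 = 0.
Hypothesis dQ : mx_deriv Q (fun t => - beta *: Q t + phi t *m (phi t)^T).

(** The input [phi phi^T] is symmetric, so the transpose of [Q] solves the same filter equation. *)
Lemma info_sym t : 0 <= t -> (Q t)^T = Q t.
Proof.
apply: (filter_unique (c := - beta) (Y := fun t => (Q t)^T) _ _ dQ).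
  by rewrite Q0 trmx0.
apply: mx_deriv_eq (mx_derivT dQ) => s _.
by rewrite linearD linearZ /= trmx_mul trmxK.
Qed.

Lemma quadform_rank1 (u x : 'cV[R]_n) :
  (x^T *m (u *m u^T) *m x) 0 0 = (u^T *m x) 0 0 ^+ 2.
Proof.
rewrite mulmxA -mulmxA mxE big_ord1 expr2; congr (_ * _).
by rewrite -[in LHS](trmxK u) -trmx_mul mxE.
Qed.

Lemma quadform_deriv (x : 'cV[R]_n) :
  sderiv (fun s => expR (beta * s) * (x^T *m Q s *m x) 0 0)
         (fun s => expR (beta * s) * ((phi s)^T *m x) 0 0 ^+ 2).
Proof.
have /(mx_derivM (mx_deriv_cst x^T)) h := filter_exp dQ.
have := mx_derivM h (mx_deriv_cst x) 0 0.
set f := (f in sderiv f _); have -> : f = (fun s => expR (beta * s) * (x^T *m Q s *m x) 0 0).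
  by apply/funext => s; rewrite /f -scalemxAr -scalemxAl mxE.
apply: sderiv_eq => t _.
by rewrite mul0mx add0r mulmx0 addr0 -scalemxAr -scalemxAl mxE quadform_rank1.
Qed.

Lemma output_cont (x : 'cV[R]_n) : cont0 (fun s => ((phi s)^T *m x) 0 0 ^+ 2).
Proof.
have h : cont0 (fun s => ((phi s)^T *m x) 0 0).
  under eq_fun do rewrite mxE; apply: cont0_sum => i.
  by under eq_fun do rewrite mxE; apply: cont0M => //; exact: cont0_cst.
by under eq_fun do rewrite expr2; exact: cont0M.
Qed.

(** Order information on [Q] comes from this formula: the integrand is nonnegative, and over a
    window of length [T] the integral compares with the excitation Gramian. *)
Lemma quadform_increase (x : 'cV[R]_n) a b : 0 <= a -> a <= b ->
  expR (beta * b) * (x^T *m Q b *m x) 0 0 - expR (beta * a) * (x^T *m Q a *m x) 0 0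
  = \int[lebesgue_measure]_(s in `[a, b]) (expR (beta * s) * ((phi s)^T *m x) 0 0 ^+ 2).
Proof.
move=> a0 ab; rewrite (sderiv_integral a0 ab (quadform_deriv x))//.
by apply: cont0M; [exact: cont0_expR|exact: output_cont].
Qed.

Lemma info_ge0 (x : 'cV[R]_n) t : 0 <= t -> 0 <= (x^T *m Q t *m x) 0 0.
Proof.
move=> t0; have := quadform_increase x (lexx 0) t0.
rewrite Q0 mulmx0 mul0mx [(0 : 'M[R]_1) 0 0]mxE mulr0 subr0 => /eqP e.
rewrite -(pmulr_rge0 _ (expR_gt0 (beta * t))) (eqP e) Rintegral_ge0// => s _.
by rewrite mulr_ge0 ?expR_ge0 ?sqr_ge0.
Qed.

Variables (Phi : 'M[R]_n) (T ka kb : R).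
Hypothesis Phi_proj : orthogonal_projection Phi.
Hypotheses (T_gt0 : 0 < T) (ka_gt0 : 0 < ka).
Hypothesis Phi_PE : forall t : R, 0 <= t ->
  let G := mx_integral t (t + T) (fun s => phi s *m (phi s)^T) in
  loewner_le (ka *: Phi) G /\ loewner_le G (kb *: Phi).

Lemma gramian_quadform (x : 'cV[R]_n) t : 0 <= t ->
  (x^T *m mx_integral t (t + T) (fun s => phi s *m (phi s)^T) *m x) 0 0 =
  \int[lebesgue_measure]_(s in `[t, t + T]) (((phi s)^T *m x) 0 0 ^+ 2).
Proof.
move=> t0; rewrite mx_integral_quadform//.
  by under eq_Rintegral do rewrite quadform_rank1.
move=> i j; under eq_fun do rewrite mxE; apply: cont0_sum => k.
by under eq_fun do rewrite mxE; exact: cont0M.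
Qed.

(** The upper excitation bound makes the output energy of [v] zero on a window around [t]. The
    monotone function [q] is then constant there, and its derivative at [t], a positive multiple of
    the squared output, must vanish. *)
Lemma output_vanish (v : 'cV[R]_n) t : Phi *m v = 0 -> 0 < t -> (phi t)^T *m v = 0.
Proof.
(* The window [[a, a + T]] starts at a nonnegative time and contains [t] in its interior, however
   small [t] is. *)
move=> Pv0 t_gt0; pose a := Num.max 0 (t - T / 2).
have a0 : 0 <= a by rewrite le_max lexx.
have at_ : a < t by rewrite gt_max t_gt0 /= ltrBlDr ltrDl divr_gt0.
have taT : t < a + T.
  have : t - T / 2 <= a by rewrite le_max lexx orbT.
  lra.
have I0 : \int[lebesgue_measure]_(s in `[a, a + T]) (((phi s)^T *m v) 0 0 ^+ 2) <= 0.
  have [_ /(loewner_quadform v)] := Phi_PE a0.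
  rewrite gramian_quadform// quadformZ -[_ *m v]mulmxA Pv0 mulmx0.
  by rewrite [(0 : 'M[R]_1) 0 0]mxE mulr0.
pose q s := expR (beta * s) * (v^T *m Q s *m v) 0 0.
have incr s : a <= s -> q a <= q s.
  move=> as_; rewrite -subr_ge0 quadform_increase// Rintegral_ge0// => u _.
  by rewrite mulr_ge0 ?expR_ge0 ?sqr_ge0.
have incr2 s : 0 <= s -> s <= a + T -> q s <= q (a + T).
  move=> as_ saT; rewrite -subr_ge0 quadform_increase// Rintegral_ge0// => u _.
  by rewrite mulr_ge0 ?expR_ge0 ?sqr_ge0.
have aT : a <= a + T by rewrite lerDl ltW.
have qaT : q (a + T) <= q a.
  rewrite -subr_le0 quadform_increase//.
  apply: (@le_trans _ _ (expR (beta * (a + T)) *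
    \int[lebesgue_measure]_(s in `[a, a + T]) (((phi s)^T *m v) 0 0 ^+ 2))).
    rewrite -RintegralZl//; last by apply: cont0_integrable => //; exact: output_cont.
    apply: le_Rintegral => //.
    - by apply: cont0_integrable => //; apply: cont0M;
        [exact: cont0_expR|exact: output_cont].
    - by apply: cont0_integrable => //; apply: cont0M;
        [exact: cont0_cst|exact: output_cont].
    move=> s; rewrite /= in_itv/= => /andP[_ saT].
    by rewrite ler_wpM2r ?sqr_ge0// ler_expR ler_pM2l.
  by rewrite pmulr_rle0 ?expR_gt0.
have qcst s : a <= s <= a + T -> q s = q a.
  move=> /andP[as_ saT]; apply/eqP; rewrite eq_le incr// andbT.
  by rewrite (le_trans _ qaT)// incr2// (le_trans a0).
have nq : \forall s \near t, (fun=> q a) s = q s.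
  have /near_in_itvoo taI : t \in `]a, (a + T)[ by rewrite in_itv/= at_ taT.
  near=> s; have : s \in `]a, (a + T)[ by near: s; exact: taI.
  by rewrite in_itv/= => /andP[as_ saT]; rewrite qcst// !ltW.
have dq0 : is_derive t 1 q 0 := near_eq_is_derive nq ((sderiv_cst (q a)).2 t t_gt0).
have [_] := (quadform_deriv v).2 t t_gt0.
have [_ ->] := dq0 => /esym/eqP; rewrite mulf_eq0 gt_eqF ?expR_gt0//= sqrf_eq0 => /eqP e.
by apply/matrixP => i j; rewrite !ord1 e mxE.
Unshelve. all: by end_near.
Qed.

(** The columns of [1 - Phi] lie in the kernel of [Phi], so [output_vanish] applies to each.
    Positive times suffice, as derivatives of signals are only constrained there. *)
Lemma regressor_in_PE t : 0 < t -> Phi *m phi t = phi t.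
Proof.
move=> t0; have [PP Ps] := Phi_proj.
have h : (phi t)^T *m (1%:M - Phi) = 0.
  apply: mulmx_ext => w; rewrite mul0mx -mulmxA; apply: output_vanish => //.
  by rewrite mulmxA mulmxBr mulmx1 PP subrr mul0mx.
move/(congr1 trmx): h; rewrite trmx_mul trmxK linearB/= trmx1 Ps trmx0.
by rewrite mulmxBl mul1mx => /eqP; rewrite subr_eq0 => /eqP.
Qed.

Lemma info_projl t : 0 <= t -> Phi *m Q t = Q t.
Proof.
apply: (filter_unique (c := - beta) (Y := fun t => Phi *m Q t) _ _ dQ).
  by rewrite Q0 mulmx0.
apply: mx_deriv_eq (mx_derivM (mx_deriv_cst Phi) dQ) => s s0.
by rewrite mul0mx add0r mulmxDr -scalemxAr mulmxA regressor_in_PE.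
Qed.

Lemma info_projr t : 0 <= t -> Q t *m Phi = Q t.
Proof.
move=> t0; have [_ Ps] := Phi_proj.
by rewrite -[LHS]trmxK trmx_mul Ps info_sym// info_projl// info_sym.
Qed.

(** Keep only the last window [[t - T, t]]: the earlier contribution is nonnegative, and inside the
    window the forgetting factor is at least [e^(-beta T)]. *)
Lemma info_lower (x : 'cV[R]_n) t : T <= t ->
  expR (- beta * T) * ka * (x^T *m Phi *m x) 0 0 <= (x^T *m Q t *m x) 0 0.
Proof.
move=> Tt; have a0 : 0 <= t - T by rewrite subr_ge0.
have ab : t - T <= t by rewrite gerBl ltW.
have := loewner_quadform x (Phi_PE a0).1.
rewrite quadformZ gramian_quadform// subrK => hG.
have h := quadform_increase x a0 ab.
have q0 : 0 <= expR (beta * (t - T)) * (x^T *m Q (t - T) *m x) 0 0.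
  by rewrite mulr_ge0 ?expR_ge0// info_ge0.
have hI : expR (beta * (t - T)) *
    \int[lebesgue_measure]_(s in `[t - T, t]) (((phi s)^T *m x) 0 0 ^+ 2) <=
    \int[lebesgue_measure]_(s in `[t - T, t]) (expR (beta * s) * ((phi s)^T *m x) 0 0 ^+ 2).
  rewrite -RintegralZl//; last by apply: cont0_integrable => //; exact: output_cont.
  apply: le_Rintegral => //.
  - by apply: cont0_integrable => //; apply: cont0M;
      [exact: cont0_cst|exact: output_cont].
  - by apply: cont0_integrable => //; apply: cont0M;
      [exact: cont0_expR|exact: output_cont].
  move=> s; rewrite /= in_itv/= => /andP[sT _].
  by rewrite ler_wpM2r ?sqr_ge0// ler_expR ler_pM2l.
rewrite -(ler_pM2l (expR_gt0 (beta * t))) mulrA mulrA -expRD.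
have -> : beta * t + - beta * T = beta * (t - T) by ring.
rewrite -mulrA (le_trans (ler_wpM2l (expR_ge0 _) hG))// (le_trans hI)//.
by rewrite -h gerBl.
Qed.

(** From time [T] on the sampled kernels are therefore exact. One inclusion is [Q Phi = Q], the
    other follows from the lower bound. *)
Lemma info_kernel t : T <= t -> kernel_mx (Q t) = kernel_mx Phi.
Proof.
move=> Tt; have t0 : 0 <= t by rewrite (le_trans (ltW T_gt0)).
have [PP Ps] := Phi_proj.
rewrite /kernel_mx; apply/seteqP; split=> v /= hv; last first.
  by rewrite -info_projr// -mulmxA hv mulmx0.
have := info_lower v Tt; rewrite -[_ *m Q t *m v]mulmxA hv mulmx0 [(0 : 'M[R]_1) 0 0]mxE.
rewrite pmulr_rle0 ?mulr_gt0 ?expR_gt0// proj_quadform//.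
exact: dotmx_le0.
Qed.

End InformationMatrix.

(** Both sides fix the kernel of [Phi] and annihilate its image. *)
Lemma kernel_basis_proj (R : realType) (n m : nat) (N : 'M[R]_(n, m)) (Phi : 'M[R]_n) :
  orthogonal_projection Phi -> orthonormal_basis N (kernel_mx Phi) ->
  N *m N^T = 1%:M - Phi.
Proof.
move=> [PP Ps] [NN NPhi].
have PN : Phi *m N = 0.
  apply: mulmx_ext => w; rewrite mul0mx -mulmxA.
  by have : kernel_mx Phi (N *m w) by rewrite -NPhi; exists w.
have NK (v : 'cV[R]_n) : Phi *m v = 0 -> N *m N^T *m v = v.
  move=> Pv; have : kernel_mx Phi v by [].
  by rewrite -NPhi => -[w _ <-]; rewrite -mulmxA [N^T *m _]mulmxA NN mul1mx.
have h : N *m N^T *m (1%:M - Phi) = 1%:M - Phi.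
  apply: mulmx_ext => w; rewrite -mulmxA NK// mulmxA mulmxBr mulmx1 PP subrr.
  by rewrite mul0mx.
have NP : N *m N^T *m Phi = 0.
  by rewrite -mulmxA -[Phi in LHS]Ps -trmx_mul PN trmx0 mulmx0.
by rewrite -h mulmxBr mulmx1 NP subr0.
Qed.

Lemma image_basis_proj (R : realType) (n m : nat) (N : 'M[R]_(n, m)) (Phi : 'M[R]_n) :
  orthogonal_projection Phi -> orthonormal_basis N (image_mx Phi) ->
  N^T *m Phi = N^T.
Proof.
move=> [PP Ps] [_ NPhi].
suff PN : Phi *m N = N by rewrite -[in LHS]Ps -trmx_mul PN.
apply: mulmx_ext => w; have : image_mx Phi (N *m w) by rewrite -NPhi; exists w.
by move=> [u _ e]; rewrite -mulmxA -e mulmxA PP.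
Qed.

(** * The projection filter *)

(** For [A = N N^T] the identity [A A^T = A] reads [A_ii = sum_k A_ik^2] on the diagonal; so
    [A_ii^2 <= A_ii], whence [A_ii <= 1], and [A_ij^2 <= A_ii]. The bound is uniform over all
    sampled kernels. *)
Lemma orthonormal_proj_le1 (R : realType) n m (N : 'M[R]_(n, m)) i j :
  N^T *m N = 1%:M -> `|(N *m N^T) i j| <= 1.
Proof.
move=> NN; set A := N *m N^T.
have AA : A *m A^T = A.
  by rewrite /A trmx_mul trmxK mulmxA -[N *m _ *m N]mulmxA NN mulmx1.
clearbody A.
have Aii : A i i = \sum_k A i k ^+ 2.
  by rewrite -[in LHS]AA mxE; apply: eq_bigr => k _; rewrite mxE expr2.
have Aik k : A i k ^+ 2 <= A i i.
  by rewrite Aii [leRHS](bigD1 k)//= lerDl sumr_ge0// => l _; rewrite sqr_ge0.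
have Aii1 : A i i <= 1.
  rewrite leNgt; apply/negP => h; have := Aik i; rewrite leNgt => /negP; apply.
  by rewrite expr2 ltr_pMr// (lt_trans ltr01).
rewrite -(ler_pXn2r (isT : (0 < 2)%N)) ?nnegrE// expr1n (real_normK (num_real _)).
exact: le_trans (Aik j) Aii1.
Qed.

Section ProjectionFilter.
Context {R : realType} (delta : R) (delta_gt0 : 0 < delta).
Implicit Types (a b c s t : R) (g : nat -> R).

(* The zero-order hold of the samples g 0, g 1, ... *)
Let zoh g s := g (Num.truncn (s / delta)).

(** The hold jumps at sampling times, so integrability has to come from measurability and
    boundedness. It is constant on each of countably many intervals. *)
Lemma measurable_zoh g a b : 0 <= a -> measurable_fun `[a, b] (zoh g).
Proof.
move=> a0; pose D k := `[k%:R * delta, k.+1%:R * delta[%classic.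
apply: (@measurable_funS _ _ _ _ (\bigcup_k D k)).
- by apply: bigcup_measurable => k _; exact: measurable_itv.
- move=> s; rewrite /= in_itv/= => /andP[as_ _].
  have s0 : 0 <= s / delta by rewrite divr_ge0 ?(ltW delta_gt0)//; exact: le_trans as_.
  exists (Num.truncn (s / delta)) => //; rewrite /D /= in_itv/=.
  by rewrite -ler_pdivlMr// -ltr_pdivrMr// truncn_itv.
- apply/measurable_fun_bigcup => [k|k]; first exact: measurable_itv.
  apply: (@eq_measurable_fun _ _ _ _ _ (fun=> g k)); last exact: measurable_cst.
  move=> s; rewrite inE /D /= in_itv/= => /andP[ks sk]; rewrite /zoh.
  congr g; apply/esym/truncn_def.
  by rewrite ler_pdivlMr// ltr_pdivrMr// ks.
Qed.

Lemma integrable_exp_zoh g c a b : 0 <= a -> (forall k, `|g k| <= 1) ->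
  (@lebesgue_measure R).-integrable `[a, b] (EFin \o (fun s => expR (c * s) * zoh g s)).
Proof.
move=> a0 g1; apply: measurable_bounded_integrable => //.
- by rewrite /= lebesgue_measure_itv/=; case: ifP => // _; rewrite -EFinB ltry.
- apply: measurable_funM; last exact: measurable_zoh.
  apply: subspace_continuous_measurable_fun => //.
  by apply: cont0_itv => //; exact: cont0_expR.
- have [C C0 hC] := cont0_bounded b (@cont0_expR R c).
  exists C; split; first exact: num_real.
  move=> M CM s; rewrite /= in_itv/= => /andP[as_ sb].
  rewrite (le_trans _ (ltW CM))// normrM -[C]mulr1 ler_pM//; last exact: g1.
  by rewrite hC// (le_trans a0 as_).
Qed.

Let I g c a b := \int[lebesgue_measure]_(s in `[a, b]) (expR (c * s) * zoh g s).

Lemma exp_integral c a b : 0 < c -> 0 <= a -> a <= b ->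
  \int[lebesgue_measure]_(s in `[a, b]) expR (c * s) =
  (expR (c * b) - expR (c * a)) / c.
Proof.
move=> c0 a0 ab.
have h : sderiv (fun s => c^-1 * expR (c * s)) (fun s => expR (c * s)).
  apply: sderiv_eq (sderivZ c^-1 (sderiv_expR c)) => t _.
  by rewrite mulrA mulVf ?mul1r// gt_eqF.
rewrite (sderiv_integral a0 ab h); last exact: cont0_expR.
by rewrite -mulrBr mulrC.
Qed.

Lemma zoh_integral_le g c t : 0 < c -> 0 <= t -> (forall k, `|g k| <= 1) ->
  `|I g c 0 t| <= expR (c * t) / c.
Proof.
move=> c0 t0 g1; apply: le_trans (le_normr_Rintegral _ _) _ => //.
  exact: integrable_exp_zoh.
apply: (@le_trans _ _ (\int[lebesgue_measure]_(s in `[0, t]) expR (c * s))).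
  apply: le_Rintegral => //.
  - by have /integrable_norm := integrable_exp_zoh c t (lexx 0) g1; apply.
  - by apply: cont0_integrable => //; exact: cont0_expR.
  move=> s _; rewrite normrM ger0_norm ?expR_ge0// ler_piMr ?expR_ge0//.
  exact: g1.
by rewrite exp_integral// ler_pM2r ?invr_gt0// mulr0 expR0 lerBlDr lerDl.
Qed.

(** Past the sampling time of index [k0] the hold is the constant [x], so the tail of the integral
    is explicit. *)
Lemma zoh_integral_split g c t k0 x : 0 < c -> (forall k, `|g k| <= 1) ->
  (forall k, (k0 <= k)%N -> g k = x) -> k0%:R * delta <= t ->
  I g c 0 t = I g c 0 (k0%:R * delta) +
    x * ((expR (c * t) - expR (c * (k0%:R * delta))) / c).
Proof.
move=> c0 g1 gx Kt; set K := k0%:R * delta in Kt *.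
have K0 : 0 <= K by rewrite mulr_ge0// ltW.
apply/eqP; rewrite addrC -subr_eq; apply/eqP.
rewrite /I Rintegral_itvB ?bnd_simp//; last exact: integrable_exp_zoh.
rewrite Rintegral_itv_obnd_cbnd; last first.
  apply: integrableS (integrable_exp_zoh c t K0 g1) => //.
  by apply: subset_itvr; rewrite bnd_simp.
rewrite -exp_integral// -RintegralZl//; last first.
  by apply: cont0_integrable => //; exact: cont0_expR.
apply: eq_Rintegral => s; rewrite inE/= in_itv/= => /andP[Ks _].
have s0 : 0 <= s / delta by rewrite divr_ge0 ?(ltW delta_gt0)//; exact: le_trans Ks.
by rewrite mulrC /zoh gx// truncn_ge_nat// ler_pdivlMr.
Qed.

Context {n : nat} (gamma : R) (Pi : nat -> 'M[R]_n) (P dP : R -> 'M[R]_n).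
Hypothesis gamma_gt0 : 0 < gamma.
Hypothesis Pi_le1 : forall k i j, `|Pi k i j| <= 1.
Hypothesis dP_P : mx_deriv P dP.
Hypothesis dP_eq : forall t : R, 0 <= t ->
  dP t = - gamma *: P t + gamma%:M - gamma ^+ 2 *: mx_integral 0 t (fun s =>
    expR (- gamma * (t - s)) *: Pi (Num.truncn (s / delta))).

Lemma zoh_mx_integral t i j : 0 <= t ->
  mx_integral 0 t (fun s =>
    expR (- gamma * (t - s)) *: Pi (Num.truncn (s / delta))) i j =
  expR (- gamma * t) * I (fun k => Pi k i j) gamma 0 t.
Proof.
move=> t0; rewrite mxE /I -RintegralZl//; last exact: integrable_exp_zoh.
apply: eq_Rintegral => s _; rewrite mxE mulrA -expRD; congr (expR _ * _); ring.
Qed.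

(** Supplies the bounded coefficients required by [linear_ode_unique], directly from the integral
    formula for [dP]. *)
Lemma proj_filter_rate_bounded b : mxO1 [set t | 0 <= t <= b] dP.
Proof.
pose V t := mx_integral 0 t (fun s =>
  expR (- gamma * (t - s)) *: Pi (Num.truncn (s / delta))).
apply: (@mxO_eq _ _ _ _ _ (fun t => - gamma *: P t + gamma%:M - gamma ^+ 2 *: V t)).
  by move=> t /andP[t0 _]; rewrite dP_eq.
apply: mxOB; first apply: mxOD.
- by apply: (mxO1Z (c := `|- gamma|)) => //; exact: mx_deriv_bounded dP_P.
- exact: mxO_cst.
apply: (mxO1Z (c := `|gamma ^+ 2|)) => //.
exists gamma^-1 => [|t /andP[t0 _] i j]; first by rewrite invr_ge0 ltW.
rewrite /V zoh_mx_integral// normrM ger0_norm ?expR_ge0// mulr1.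
apply: le_trans (ler_wpM2l (expR_ge0 _) (zoh_integral_le gamma_gt0 t0 _)) _ => //.
by rewrite mulrA -expRD mulNr addNr expR0 mul1r.
Qed.

Context (Phi : 'M[R]_n) (k0 : nat).
Hypothesis Pi_eventually : forall k, (k0 <= k)%N -> Pi k = 1%:M - Phi.

(** Once the samples are exact, an entry [x] of [P - Phi] solves the resonant equation
    [x' = - gamma x + c1 e^(- gamma t)]; resonance produces the linear factor. *)
Lemma proj_filter_linear i j : exists A B : R, [/\ 0 <= A, 0 <= B &
  forall t, 0 <= t -> `|P t i j - Phi i j| <= expR (- gamma * t) * (A + B * t)].
Proof.
set K := k0%:R * delta; have K0 : 0 <= K by rewrite mulr_ge0// ltW.
pose g k := Pi k i j.
(* Up to the factor [- gamma^2], this compares the weighted samples before [K] with a hold equal to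
   [1 - Phi] since time minus infinity. *)
pose c1 := - gamma ^+ 2 * (I g gamma 0 K -
  ((i == j)%:R - Phi i j) * (expR (gamma * K) / gamma)).
have g0 : gamma != 0 by rewrite gt_eqF.
have entry (A V : 'M[R]_n) : (- gamma *: A + gamma%:M - gamma ^+ 2 *: V) i j =
    - gamma * A i j + gamma * (i == j)%:R - gamma ^+ 2 * V i j.
  by rewrite !mxE mulr_natr.
have dPK t : K <= t ->
    dP t i j = - gamma * (P t i j - Phi i j) + expR (- gamma * t) * c1.
  move=> Kt; have t0 := le_trans K0 Kt.
  rewrite dP_eq// entry zoh_mx_integral//.
  rewrite (zoh_integral_split (x := (i == j)%:R - Phi i j) gamma_gt0 _ _ Kt)//; last first.
    by move=> k /Pi_eventually ->; rewrite !mxE.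
  rewrite /c1 -/K -/g [- gamma * t]mulNr expRN.
  set F := expR (gamma * t); have F0 : F != 0 by rewrite gt_eqF ?expR_gt0.
  by field; rewrite g0 F0.
pose f t := expR (gamma * t) * (P t i j + - Phi i j) + - c1 * t.
have df : sderiv f (fun t => gamma * expR (gamma * t) * (P t i j + - Phi i j) +
    expR (gamma * t) * (dP t i j + 0) + - c1 * 1).
  apply: sderivD; last exact: sderivZ sderiv_id.
  apply: sderivM; first exact: sderiv_expR.
  by apply: sderivD; [exact: dP_P|exact: sderiv_cst].
have df0 t : K <= t -> gamma * expR (gamma * t) * (P t i j + - Phi i j) +
    expR (gamma * t) * (dP t i j + 0) + - c1 * 1 = 0.
  move=> Kt; rewrite dPK// [- gamma * t]mulNr expRN.
  set F := expR (gamma * t); have F0 : F != 0 by rewrite gt_eqF ?expR_gt0.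
  by field.
have fK t : K <= t -> f t = f K.
  move=> Kt; apply/eqP; rewrite eq_le; apply/andP; split.
    by apply: sderiv_le0 K0 Kt df _ => s /andP[/ltW/df0 ->].
  by apply: sderiv_ge0 K0 Kt df _ => s /andP[/ltW/df0 ->].
have [M M0 hM] := cont0_bounded K (cont0D (dP_P i j).1 (@cont0_cst R (- Phi i j))).
(* On [[0, K]] the error is at most [M <= M e^(gamma K) e^(- gamma t)]. After [K], [f] is constant
   and the error is [e^(- gamma t) (f K + c1 t)]. *)
exists (M * expR (gamma * K) + `|f K|), `|c1|; split => //.
  by rewrite addr_ge0// mulr_ge0// expR_ge0.
move=> t t0; have [tK|/ltW Kt] := leP t K.
  apply: (@le_trans _ _ M); first by apply: hM; rewrite t0.
  rewrite -addrA mulrDr; apply: ler_wpDr.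
    by rewrite mulr_ge0 ?expR_ge0// addr_ge0// mulr_ge0.
  rewrite mulrCA ler_peMr// -expRD -expR0 ler_expR mulNr addrC subr_ge0.
  by rewrite ler_pM2l.
have -> : P t i j - Phi i j = expR (- gamma * t) * (f K + c1 * t).
  rewrite -(fK t Kt) /f [- gamma * t]mulNr expRN.
  set F := expR (gamma * t); have F0 : F != 0 by rewrite gt_eqF ?expR_gt0.
  by field.
rewrite normrM ger0_norm ?expR_ge0// ler_wpM2l ?expR_ge0//.
rewrite (le_trans (ler_normD _ _))// normrM (ger0_norm t0) lerD2r lerDr.
by rewrite mulr_ge0// expR_ge0.
Qed.

(** The linear factor is paid for by the gap [nu = gamma - rho], through [t <= e^(nu t) / nu]. *)
Lemma proj_filter_decay rho : rho < gamma ->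
  mxO [set t | 0 <= t] (fun t => expR (- rho * t)) (fun t => P t - Phi).
Proof.
move=> rg; apply: mxO_entry => [i j|t _]; last exact: expR_ge0.
have [A [B [A0 B0 h]]] := proj_filter_linear i j.
have nu0 : 0 < gamma - rho by rewrite subr_gt0.
exists (A + B / (gamma - rho)); first by rewrite addr_ge0// divr_ge0// ltW.
move=> t t0; rewrite !mxE (le_trans (h t t0))//.
have -> : expR (- rho * t) = expR (- gamma * t) * expR ((gamma - rho) * t).
  by rewrite -expRD; congr expR; ring.
rewrite mulrCA ler_pM2l ?expR_gt0// mulrDl lerD//.
  by rewrite ler_peMr// -expR0 ler_expR mulr_ge0// ltW.
rewrite -mulrA ler_wpM2l// ler_pdivlMl//.
by apply: le_trans (expR_ge1Dx _); rewrite lerDr.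
Qed.

End ProjectionFilter.

(** * The least squares problem *)

Lemma enormE (R : realType) n (v : 'cV[R]_n) : enorm v ^+ 2 = (v^T *m v) 0 0.
Proof.
rewrite sqr_sqrtr; last by rewrite sumr_ge0// => i _; rewrite sqr_ge0.
by rewrite mxE; apply: eq_bigr => i _; rewrite mxE expr2.
Qed.

Lemma dotmxC (R : realType) n (x y : 'cV[R]_n) : (x^T *m y) 0 0 = (y^T *m x) 0 0.
Proof. by rewrite -[in LHS](trmxK y) -trmx_mul mxE. Qed.

Lemma dotmxDr (R : realType) n (x y w : 'cV[R]_n) :
  (w^T *m (x + y)) 0 0 = (w^T *m x) 0 0 + (w^T *m y) 0 0.
Proof. by rewrite mulmxDr mxE. Qed.

Lemma dotmxBr (R : realType) n (x y w : 'cV[R]_n) :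
  (w^T *m (x - y)) 0 0 = (w^T *m x) 0 0 - (w^T *m y) 0 0.
Proof. by rewrite mulmxBr mxE [X in _ + X]mxE. Qed.

Lemma dotmxZr (R : realType) n c (x y : 'cV[R]_n) :
  (y^T *m (c *: x)) 0 0 = c * (y^T *m x) 0 0.
Proof. by rewrite -scalemxAr mxE. Qed.

Lemma quadform_line (R : realType) n (A : 'M[R]_n) (x y : 'cV[R]_n) s : A^T = A ->
  ((x + s *: y)^T *m A *m (x + s *: y)) 0 0 =
  (x^T *m A *m x) 0 0 + 2 * s * (y^T *m A *m x) 0 0 + s ^+ 2 * (y^T *m A *m y) 0 0.
Proof.
move=> As; have sym : (x^T *m A *m y) 0 0 = (y^T *m A *m x) 0 0.
  by rewrite -mulmxA dotmxC trmx_mul As.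
rewrite [(x + _)^T]linearD /= [(s *: y)^T]linearZ /=.
rewrite !(mulmxDl, mulmxDr) -!(scalemxAl, scalemxAr).
move: sym; set a := x^T *m A *m x; set b := x^T *m A *m y.
set c := y^T *m A *m x; set d := y^T *m A *m y => sym.
by clearbody a b c d; rewrite !mxE sym; ring.
Qed.

Lemma dotmx_sqrD (R : realType) n (x y : 'cV[R]_n) s :
  ((x + s *: y)^T *m (x + s *: y)) 0 0 =
  (x^T *m x) 0 0 + 2 * s * (y^T *m x) 0 0 + s ^+ 2 * (y^T *m y) 0 0.
Proof. by have := quadform_line x y s (trmx1 R n); rewrite !mulmx1. Qed.

Section LeastSquares.
Context {R : realType} {n : nat} (phi : R -> 'cV[R]_n) (z : R -> R)
  (alpha beta : R) (theta0 : 'cV[R]_n) (Q : R -> 'M[R]_n) (varphi : R -> 'cV[R]_n).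
Implicit Types (t : R) (v : 'cV[R]_n).
Hypotheses (alpha_gt0 : 0 < alpha) (beta_gt0 : 0 < beta).
Hypothesis phi_cont : forall i j, cont0 (fun t => phi t i j).
Hypothesis z_cont : cont0 z.
Hypothesis Q0 : Q 0 = 0.
Hypothesis dQ : mx_deriv Q (fun t => - beta *: Q t + phi t *m (phi t)^T).
Hypothesis varphi0 : varphi 0 = alpha *: theta0.
Hypothesis dvarphi : mx_deriv varphi (fun t => - beta *: varphi t + z t *: phi t).

Let prior t := alpha * expR (- beta * t).

Let output_cont1 v : cont0 (fun s => (v^T *m phi s) 0 0).
Proof.
under eq_fun do rewrite mxE; apply: cont0_sum => i.
by apply: cont0M => //; exact: cont0_cst.
Qed.

(** [e^(beta s) prior s] is the constant [alpha], so subtracting the prior removes the initial value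
    of [varphi] and leaves a primitive of the cross term of the cost. *)
Lemma cross_term_deriv v :
  sderiv (fun s => expR (beta * s) * (v^T *m (varphi s - prior s *: theta0)) 0 0)
         (fun s => expR (beta * s) * (z s * (v^T *m phi s) 0 0)).
Proof.
have h := sderivD (mx_derivM (mx_deriv_cst v^T) (filter_exp dvarphi) 0 0)
                  (sderiv_cst (- (alpha * (v^T *m theta0) 0 0))).
move: h; set f := (f in sderiv f _).
have -> : f = (fun s => expR (beta * s) * (v^T *m (varphi s - prior s *: theta0)) 0 0).
  apply/funext => s; rewrite /f /prior /= dotmxZr dotmxBr dotmxZr.
  have E1 : expR (beta * s) * expR (- beta * s) = 1.
    by rewrite -expRD mulNr subrr expR0.
  by rewrite mulrDr -[in LHS](mul1r alpha) -E1; ring.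
apply: sderiv_eq => s _.
by rewrite mul0mx add0r addr0 -scalemxAr -scalemxAr !mxE.
Qed.

(** After expanding the square, [g] collects the terms that depend on [v]; it is integrated through
    the primitives built from [Q] and [varphi]. The [z^2] term and the norm of [theta0] form [C]. *)
Lemma ls_cost_quadratic t : 0 <= t -> exists C, forall v,
  ls_cost phi z alpha beta theta0 t v =
  C + 2^-1 * ((v^T *m Q t *m v) 0 0 + prior t * (v^T *m v) 0 0) - (v^T *m varphi t) 0 0.
Proof.
move=> t0.
exists (2^-1 * \int[lebesgue_measure]_(s in `[0, t]) (expR (- beta * (t - s)) * z s ^+ 2)
        + alpha / 2 * expR (- beta * t) * (theta0^T *m theta0) 0 0) => v.
have cw : cont0 (fun s => expR (- beta * (t - s))).
  have -> : (fun s => expR (- beta * (t - s))) =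
            (fun s => expR (- beta * t) * expR (beta * s)).
    by apply/funext => s; rewrite -expRD; congr expR; ring.
  by apply: cont0M; [exact: cont0_cst|exact: cont0_expR].
pose g s := expR (- beta * t) * (expR (beta * s) * ((phi s)^T *m v) 0 0 ^+ 2 +
   -2 * (expR (beta * s) * (z s * (v^T *m phi s) 0 0))).
have cg : cont0 g.
  apply: cont0M; first exact: cont0_cst.
  apply: cont0D; first by apply: cont0M; [exact: cont0_expR|exact: output_cont].
  apply: cont0M; first exact: cont0_cst.
  by apply: cont0M; [exact: cont0_expR|exact: cont0M].
have dg := sderivZ (expR (- beta * t))
  (sderivD (quadform_deriv dQ v) (sderivZ (-2) (cross_term_deriv v))).
have Ig := sderiv_integral (lexx 0) t0 dg cg.
have czz : cont0 (fun s => expR (- beta * (t - s)) * z s ^+ 2).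
  by apply: cont0M => //; under eq_fun do rewrite expr2; exact: cont0M.
rewrite /ls_cost.
have -> : \int[lebesgue_measure]_(s in `[0, t])
     (expR (- beta * (t - s)) * (z s - (v^T *m phi s) 0 0) ^+ 2) =
   \int[lebesgue_measure]_(s in `[0, t]) (expR (- beta * (t - s)) * z s ^+ 2) +
   \int[lebesgue_measure]_(s in `[0, t]) g s.
  rewrite -RintegralD//; try by exact: cont0_integrable.
  apply: eq_Rintegral => s _; rewrite /g (dotmxC (phi s)) .
  have -> : expR (- beta * (t - s)) = expR (- beta * t) * expR (beta * s).
    by rewrite -expRD; congr expR; ring.
  ring.
rewrite Ig Q0 varphi0 /prior !mulr0 !expR0 !mulr1 subrr !mulmx0 mul0mx ![(0 : 'M[R]_1) 0 0]mxE.
have E1 : expR (- beta * t) * expR (beta * t) = 1.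
  by rewrite -expRD mulNr addNr expR0.
rewrite enormE -[- theta0]scaleN1r dotmx_sqrD dotmxBr dotmxZr (dotmxC theta0 v).
move: E1; set E := expR (- beta * t); set F := expR (beta * t) => E1.
set qv := (v^T *m Q t *m v) 0 0; set vv := (v^T *m v) 0 0.
set b := (v^T *m varphi t) 0 0; set w := (v^T *m theta0) 0 0.
have -> : F = E^-1 by rewrite /E mulNr expRN invrK.
have E0 : E != 0 by rewrite gt_eqF ?expR_gt0.
by field.
Qed.

(** The residual [r] is the gradient of the cost at [v]. Were it nonzero, a step along [- r] would
    lower the cost. *)
Lemma normal_equation t v : 0 <= t ->
  is_minimizer (ls_cost phi z alpha beta theta0 t) v ->
  Q t *m v + prior t *: v = varphi t.
Proof.
move=> t0 vmin; have [C hC] := ls_cost_quadratic t0.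
pose r := Q t *m v + prior t *: v - varphi t.
suff : (r^T *m r) 0 0 <= 0 by move=> /dotmx_le0/subr0_eq.
rewrite leNgt; apply/negP; set B := (r^T *m r) 0 0 => B0.
pose A := (r^T *m Q t *m r) 0 0 + prior t * B.
have A0 : 0 <= A.
  rewrite addr_ge0 ?(info_ge0 phi_cont Q0 dQ)// mulr_ge0 ?(ltW B0)//.
  by rewrite mulr_ge0 ?expR_ge0// ltW.
(* The cost changes by [s B + s^2 A / 2]. The 1 keeps the denominator positive when [A = 0]; since
   [s A = - B - s], the change is [s (B - s) / 2], which is negative. *)
pose s := - B / (A + 1).
have := vmin (v + s *: r); rewrite !hC quadform_line; last exact: info_sym t0.
rewrite dotmx_sqrD [((v + _)^T *m _) 0 0]dotmxC dotmxDr dotmxZr.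
rewrite (dotmxC (varphi t) v) (dotmxC (varphi t) r).
have BE : B = (r^T *m Q t *m v) 0 0 + prior t * (r^T *m v) 0 0 - (r^T *m varphi t) 0 0.
  by rewrite /B {2}/r dotmxBr dotmxDr dotmxZr mulmxA.
have sE : s * (A + 1) = - B by rewrite /s divfK// gt_eqF// ltr_wpDl.
have s0 : s < 0 by rewrite /s mulNr oppr_lt0 divr_gt0// ltr_wpDl.
clearbody s; rewrite -subr_ge0.
set X := (X in 0 <= X); have -> : X = s * B + s ^+ 2 * A / 2.
  rewrite /X -/B [in RHS]BE /A.
  by field.
have : s * B + s ^+ 2 * A / 2 = s * (B / 2 - s / 2).
  have -> : s ^+ 2 * A = s * (- B - s) by rewrite -sE; ring.
  by field.
move=> ->; rewrite leNgt => /negP; apply.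
by rewrite nmulr_rlt0//; lra.
Qed.

End LeastSquares.

(** * The inverse of the gain *)

Section LearningAlgorithm.
Context {R : realType} {n : nat} (phi : R -> 'cV[R]_n) (z : R -> R)
  (alpha beta kappa : R) (theta0 : 'cV[R]_n)
  (Q P dP Omega : R -> 'M[R]_n) (varphi theta_d : R -> 'cV[R]_n).
Implicit Types (t : R).
Hypothesis kappa_gt0 : 0 < kappa.
Hypothesis phi_cont : forall i j, cont0 (fun t => phi t i j).
Hypothesis dQ : mx_deriv Q (fun t => - beta *: Q t + phi t *m (phi t)^T).
Hypothesis dvarphi : mx_deriv varphi (fun t => - beta *: varphi t + z t *: phi t).
Hypothesis P0 : P 0 = 0.
Hypothesis dP_P : mx_deriv P dP.
Hypothesis dP_bounded : forall b, mxO1 [set t | 0 <= t <= b] dP.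

Let prior t := alpha * expR (- beta * t).
Let L t := learning_R alpha beta kappa t (phi t) (Q t) (P t) (dP t).

Hypothesis theta_d0 : theta_d 0 = 0.
Hypothesis dtheta_d : mx_deriv theta_d (fun t =>
  - (Omega t *m (L t *m theta_d t - z t *: (P t *m phi t) - dP t *m varphi t))).
Hypothesis Omega0 : Omega 0 = kappa^-1%:M.
Hypothesis dOmega : mx_deriv Omega (fun t =>
  beta *: Omega t - Omega t *m L t *m Omega t).

(* Turns out to be the inverse of the gain Omega. *)
Let W t := P t *m Q t *m P t + kappa *: (1%:M - P t) + prior t *: P t.

Lemma prior_deriv : sderiv prior (fun t => - beta * prior t).
Proof.
by apply: sderiv_eq (sderivZ alpha (sderiv_expR (- beta))) => t _; rewrite mulrCA.
Qed.

Lemma gain_inverse_deriv : mx_deriv W (fun t => - beta *: W t + L t).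
Proof.
have h := mx_derivD (mx_derivD (mx_derivM (mx_derivM dP_P dQ) dP_P)
  (mx_derivZc kappa (mx_derivB (mx_deriv_cst 1%:M) dP_P)))
  (mx_derivZ prior_deriv dP_P).
apply: mx_deriv_eq h => t _; rewrite /W /L /learning_R -/(prior t).
rewrite !(mulmxDl, mulmxDr) -!(scalemxAr, scalemxAl) !mulmxA.
set A := dP t *m Q t *m P t; set B := P t *m Q t *m P t.
set C := P t *m phi t *m (phi t)^T *m P t; set D := P t *m Q t *m dP t.
set E := P t; set F := dP t; set I := (1%:M : 'M[R]_n).
clearbody A B C D E F I; apply/matrixP => i j; rewrite !mxE.
ring.
Qed.

Lemma learning_R_bounded b : mxO1 [set t | 0 <= t <= b] L.
Proof.
have bP := mx_deriv_bounded b dP_P; have bQ := mx_deriv_bounded b dQ.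
have bphi := mx_cont_bounded b phi_cont; have bdP := dP_bounded b.
have bphiT : mxO1 [set t | 0 <= t <= b] (fun t => (phi t)^T).
  by apply: mx_cont_bounded => i j; under eq_fun do rewrite mxE; exact: phi_cont.
have [C C0 hC] := cont0_bounded b (cont0D prior_deriv.1 (@cont0_cst R (- kappa))).
rewrite /L /learning_R; apply: mxOD; last by apply: (mxO1Z hC).
apply: mxOD; last by apply: mxOMl => //; exact: mxOMl.
apply: mxOD; last by apply: mxOMl => //; exact: mxOMl.
apply: mxOD; last first.
  apply: (mxO1Z (c := `|kappa * beta|)) => //.
  by apply: mxOB => //; exact: mxO_cst.
by do 3 apply: mxOMl => //.
Qed.

(** The defect [X = 1 - Omega W] solves the linear equation [X' = - (Omega L) X], and it starts at 0
    because [P 0 = 0] makes [W 0] equal to [kappa] times the identity. *)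
Lemma gain_inverse t : 0 <= t -> Omega t *m W t = 1%:M.
Proof.
move=> t0; apply/esym/subr0_eq.
apply: (@linear_ode_unique _ _ _ (fun t => - (Omega t *m L t))
  (fun t => 1%:M - Omega t *m W t)) t0 => //.
- rewrite /W P0 mulmx0 scaler0 subr0 add0r addr0 Omega0.
  by rewrite scalemx1 -scalar_mxM mulVf ?subrr// gt_eqF.
- apply: mx_deriv_eq (mx_derivB (mx_deriv_cst 1%:M)
    (mx_derivM dOmega gain_inverse_deriv)) => s _.
  move: (W s) (L s) (Omega s) => V M G.
  rewrite mulmxBl mulmxDr mulNmx mulmxBr mulmx1 -scalemxAl -scalemxAr !mulmxA scaleNr.
  move: (G *m M *m G *m V) (G *m V) (G *m M) => A B C.
  by apply/matrixP => i j; rewrite !mxE; ring.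
- move=> b; apply: mxON; apply: mxOMl; last exact: learning_R_bounded.
  exact: mx_deriv_bounded dOmega.
Qed.

(** In the derivative of the left side [W Omega = 1] cancels the gain and the two [L theta_d] terms
    cancel; both sides then filter the same input. *)
Lemma gain_inverse_theta_d t : 0 <= t -> W t *m theta_d t = P t *m varphi t.
Proof.
apply: (filter_unique (c := - beta)
  (U := fun t => z t *: (P t *m phi t) + dP t *m varphi t)
  (Y := fun t => W t *m theta_d t) (Z := fun t => P t *m varphi t)).
- by rewrite theta_d0 P0 mulmx0 mul0mx.
- apply: mx_deriv_eq (mx_derivM gain_inverse_deriv dtheta_d) => s s0.
  rewrite mulmxN [W s *m (Omega s *m _)]mulmxA (mulmx1C (gain_inverse (ltW s0))) mul1mx.
  rewrite [(_ + L s) *m _]mulmxDl -scalemxAl.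
  move: (W s *m theta_d s) (L s *m theta_d s) (P s *m phi s) (dP s *m varphi s) => A B C D.
  by apply/matrixP => i j; rewrite !mxE; ring.
- apply: mx_deriv_eq (mx_derivM dP_P dvarphi) => s _.
  rewrite mulmxDr -!scalemxAr.
  move: (P s *m phi s) (P s *m varphi s) (dP s *m varphi s) => A B C.
  by apply/matrixP => i j; rewrite !mxE; ring.
Qed.

End LearningAlgorithm.

(** * Error estimates *)

Lemma coercive_mxO (R : realType) n (D : set R) (r : R -> R) c (A : R -> 'M[R]_n)
    (X Y : R -> 'cV[R]_n) : 0 < c ->
  (forall t, D t -> forall x : 'cV[R]_n, c * (x^T *m x) 0 0 <= (x^T *m A t *m x) 0 0) ->
  (forall t, D t -> A t *m X t = Y t) -> mxO D r Y -> mxO D r X.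
Proof.
move=> c0 hA AX [C C0 hC]; exists (n%:R / c * C).
  by rewrite mulr_ge0// divr_ge0// ltW.
move=> t Dt i j; rewrite ord1 -[_ * C * _]mulrA.
by apply: (coercive_bound c0 (hA t Dt (X t)) (AX t Dt)) => k; exact: hC.
Qed.

Lemma quadform_proj_compl (R : realType) n (x : 'cV[R]_n) (Phi : 'M[R]_n) :
  (x^T *m (1%:M - Phi) *m x) 0 0 = (x^T *m x) 0 0 - (x^T *m Phi *m x) 0 0.
Proof. by rewrite mulmxBr mulmx1 mulmxBl mxE [X in _ + X]mxE. Qed.

Section Convergence.
Context {R : realType} {n : nat} (phi : R -> 'cV[R]_n) (z : R -> R)
  (alpha beta kappa : R) (theta0 : 'cV[R]_n)
  (Q : R -> 'M[R]_n) (varphi theta_star : R -> 'cV[R]_n).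
Implicit Types (t : R).
Hypotheses (alpha_gt0 : 0 < alpha) (beta_gt0 : 0 < beta) (kappa_gt0 : 0 < kappa).
Hypothesis phi_cont : forall i j, cont0 (fun t => phi t i j).
Hypothesis phi_bounded : mxO1 [set t | 0 <= t] phi.
Hypothesis z_bounded : exists M : R, forall t, 0 <= t -> `|z t| <= M.
Hypothesis Q0 : Q 0 = 0.
Hypothesis dQ : mx_deriv Q (fun t => - beta *: Q t + phi t *m (phi t)^T).
Hypothesis varphi0 : varphi 0 = alpha *: theta0.
Hypothesis dvarphi : mx_deriv varphi (fun t => - beta *: varphi t + z t *: phi t).
Variables (Phi : 'M[R]_n) (T ka kb : R).
Hypothesis Phi_proj : orthogonal_projection Phi.
Hypotheses (T_gt0 : 0 < T) (ka_gt0 : 0 < ka).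
Hypothesis Phi_PE : forall t, 0 <= t ->
  let G := mx_integral t (t + T) (fun s => phi s *m (phi s)^T) in
  loewner_le (ka *: Phi) G /\ loewner_le G (kb *: Phi).

Let prior t := alpha * expR (- beta * t).
Hypothesis normal_eq : forall t, 0 <= t ->
  Q t *m theta_star t + prior t *: theta_star t = varphi t.

(* What the inverse gain becomes once P is replaced by its limit Phi. *)
Let Winf t := Q t + kappa *: (1%:M - Phi) + prior t *: Phi.

Let QPhi t : 0 <= t -> Q t *m Phi = Q t.
Proof. exact: (info_projr beta_gt0 phi_cont Q0 dQ Phi_proj T_gt0 Phi_PE). Qed.

Let PhiQ t : 0 <= t -> Phi *m Q t = Q t.
Proof. exact: (info_projl beta_gt0 phi_cont Q0 dQ Phi_proj T_gt0 Phi_PE). Qed.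

Let prior_le t : 0 <= t -> `|prior t| <= alpha.
Proof.
move=> t0; rewrite ger0_norm ?mulr_ge0 ?expR_ge0 ?(ltW alpha_gt0)//.
by rewrite ler_piMr ?(ltW alpha_gt0)// -expR0 ler_expR mulNr oppr_le0 mulr_ge0// ltW.
Qed.

Let Q_bounded : mxO1 [set t | 0 <= t] Q.
Proof.
apply: (filter_bounded beta_gt0 dQ); apply: mxOMl => //.
by have [C C0 h] := phi_bounded; exists C => // t t0 i j; rewrite mxE h.
Qed.

Let varphi_bounded : mxO1 [set t | 0 <= t] varphi.
Proof.
have [M hM] := z_bounded.
by apply: (filter_bounded beta_gt0 dvarphi); exact: mxO1Z hM _.
Qed.

(** On the kernel of [Phi] the [kappa] term is coercive. On its image [info_lower] takes care of
    times after [T], and before [T] the prior is still at least [alpha e^(-beta T)]. *)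
Lemma limit_gain_coercive : exists2 c, 0 < c & forall t, 0 <= t ->
  forall x : 'cV[R]_n, c * (x^T *m x) 0 0 <= (x^T *m Winf t *m x) 0 0.
Proof.
pose e := expR (- beta * T); have e0 : 0 < e := expR_gt0 _.
pose c1 := Num.min (e * ka) (e * alpha).
have c10 : 0 < c1 by rewrite lt_min !mulr_gt0.
exists (Num.min c1 kappa) => [|t t0 x]; first by rewrite lt_min c10.
rewrite /Winf !quadformD !quadformZ quadform_proj_compl.
set s := (x^T *m x) 0 0; set p := (x^T *m Phi *m x) 0 0.
set q := (x^T *m Q t *m x) 0 0.
have p0 : 0 <= p by rewrite /p proj_quadform//; exact: dotmx_ge0.
have ps : p <= s.
  have cPhi : orthogonal_projection (1%:M - Phi).
    have [PP Ps] := Phi_proj; split.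
      by rewrite mulmxBl mul1mx mulmxBr mulmx1 PP subrr subr0.
    by rewrite linearB /= trmx1 Ps.
  by rewrite -subr_ge0 -quadform_proj_compl proj_quadform//; exact: dotmx_ge0.
have q0 : 0 <= q by exact: (info_ge0 phi_cont Q0 dQ).
have pr0 : 0 <= prior t by rewrite mulr_ge0 ?expR_ge0// ltW.
have qp : c1 * p <= q + prior t * p.
  have [Tt|tT] := leP T t.
    apply: ler_wpDr; first exact: mulr_ge0.
    have := info_lower beta_gt0 phi_cont Q0 dQ T_gt0 Phi_PE x Tt; apply: le_trans.
    by rewrite ler_wpM2r// ge_min lexx.
  apply: ler_wpDl => //; rewrite ler_wpM2r// ge_min; apply/orP; right.
  rewrite mulrC ler_wpM2l ?(ltW alpha_gt0)// ler_expR !mulNr lerN2 ler_wpM2l//; exact: ltW.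
have h1 : Num.min c1 kappa * p <= c1 * p by rewrite ler_wpM2r// ge_min lexx.
have h2 : Num.min c1 kappa * (s - p) <= kappa * (s - p).
  by rewrite ler_wpM2r ?subr_ge0// ge_min lexx orbT.
rewrite -[s in leLHS](subrK p) mulrDr.
apply: le_trans (lerD h2 (le_trans h1 qp)) _.
by rewrite addrCA addrA.
Qed.

(** The free offset [v] is taken to be [theta0] for boundedness, [theta] in the noise-free case and
    0 for the error of [theta_d]. *)
Lemma limit_gain_Phi t (v : 'cV[R]_n) : 0 <= t ->
  Winf t *m (Phi *m (theta_star t - v)) =
  Phi *m varphi t - Q t *m v - prior t *: (Phi *m v).
Proof.
move=> t0; have [PP _] := Phi_proj.
rewrite -normal_eq// mulmxDr !mulmxA PhiQ// -scalemxAr mulmxBr.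
have -> : Winf t *m Phi = Q t + prior t *: Phi.
  rewrite /Winf !mulmxDl QPhi// -!scalemxAl mulmxBl mul1mx PP subrr.
  by rewrite scaler0 addr0.
rewrite !mulmxDl -!scalemxAl.
by rewrite opprD addrA.
Qed.

(** Off the PE subspace [varphi] receives no input and equals the prior times [theta0]. Projecting
    the normal equation and dividing by the positive prior gives the claim. *)
Lemma theta_star_unexcited t : 0 <= t ->
  theta_star t - theta0 = Phi *m (theta_star t - theta0).
Proof.
move=> t0; have [PP _] := Phi_proj.
have phi0 s : 0 < s -> (1%:M - Phi) *m phi s = 0.
  move=> s0; rewrite mulmxBl mul1mx.
  by rewrite (regressor_in_PE beta_gt0 phi_cont dQ Phi_proj T_gt0 Phi_PE s0) subrr.
have e : (1%:M - Phi) *m varphi t = prior t *: ((1%:M - Phi) *m theta0).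
  apply: (filter_unique (c := - beta) (U := fun=> 0)
    (Y := fun t => (1%:M - Phi) *m varphi t)
    (Z := fun t => prior t *: ((1%:M - Phi) *m theta0))) t0.
  - by rewrite varphi0 /prior mulr0 expR0 mulr1 -scalemxAr.
  - apply: mx_deriv_eq (mx_derivM (mx_deriv_cst (1%:M - Phi)) dvarphi) => s s0.
    by rewrite mul0mx add0r mulmxDr -!scalemxAr phi0// scaler0.
  - apply: mx_deriv_eq (mx_derivZ (prior_deriv alpha beta)
      (mx_deriv_cst ((1%:M - Phi) *m theta0))) => s _.
    by rewrite scaler0 scalerA.
move: e; rewrite -normal_eq// mulmxDr mulmxA [(1%:M - Phi) *m Q t]mulmxBl mul1mx.
rewrite PhiQ// subrr mul0mx add0r -scalemxAr.
have p0 : prior t != 0 by rewrite gt_eqF// mulr_gt0// expR_gt0.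
move=> /(scalerI p0) /eqP; rewrite -subr_eq0 -mulmxBr mulmxBl mul1mx subr_eq0.
by move/eqP.
Qed.

(** The matrix [Q + prior] of the normal equation may degenerate on the kernel of [Phi] as [t]
    grows, so the bound goes through the uniformly coercive [Winf]. *)
Lemma theta_star_bounded : mxO1 [set t | 0 <= t] theta_star.
Proof.
have [c c0 hc] := limit_gain_coercive.
apply: (@mxO_eq _ _ _ _ _ (fun t => Phi *m (theta_star t - theta0) + theta0)).
  by move=> t t0; rewrite -theta_star_unexcited// subrK.
apply: mxOD; last exact: mxO_cst.
apply: (coercive_mxO (D := [set t | 0 <= t]) (A := Winf)
  (X := fun t => Phi *m (theta_star t - theta0))
  (Y := fun t => Phi *m varphi t - Q t *m theta0 - prior t *: (Phi *m theta0)) c0 hc) => [t t0|].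
  exact: limit_gain_Phi.
apply: mxOB; last by apply: (mxO1Z prior_le); exact: mxO_cst.
apply: mxOB; first by apply: mxOMl => //; exact: mxO_cst.
by apply: mxOMr => //; exact: mxO_cst.
Qed.

Lemma theta_star_noise_free (theta : 'cV[R]_n) :
  (forall t, 0 <= t -> z t = ((phi t)^T *m theta) 0 0) ->
  mxO [set t | 0 <= t] (fun t => expR (- beta * t))
    (fun t => Phi *m (theta_star t - theta)).
Proof.
move=> zE; have [c c0 hc] := limit_gain_coercive.
(* With [z = phi^T theta] the input [z phi] is [phi phi^T theta], that of [Q] applied to [theta];
   the prior carries the initial value. *)
have e t : 0 <= t -> varphi t = Q t *m theta + prior t *: theta0.
  apply: (filter_unique (c := - beta) (U := fun t => z t *: phi t)
    (Y := varphi) (Z := fun t => Q t *m theta + prior t *: theta0)) => //.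
    by rewrite varphi0 Q0 mul0mx add0r /prior mulr0 expR0 mulr1.
  apply: mx_deriv_eq (mx_derivD (mx_derivM dQ (mx_deriv_cst theta))
    (mx_derivZ (prior_deriv alpha beta) (mx_deriv_cst theta0))) => s s0.
  rewrite mulmx0 addr0 scaler0 addr0 mulmxDl -scalemxAl -mulmxA.
  rewrite [(phi s)^T *m theta]mx11_scalar mul_mx_scalar -zE ?(ltW s0)//.
  by rewrite -/(prior s) scalerDr scalerA addrAC.
apply: (coercive_mxO (D := [set t | 0 <= t]) (A := Winf)
  (X := fun t => Phi *m (theta_star t - theta))
  (Y := fun t => Phi *m varphi t - Q t *m theta - prior t *: (Phi *m theta)) c0 hc) => [t t0|].
  exact: limit_gain_Phi.
apply: (@mxO_eq _ _ _ _ _ (fun t => prior t *: (Phi *m (theta0 - theta)))).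
  move=> t t0; rewrite e// mulmxDr mulmxA PhiQ// -scalemxAr.
  by rewrite [_ *m theta + _]addrC addrK mulmxBr scalerBr.
apply: (@mxO_rate _ _ (fun t => expR (- beta * t) * 1) _ 1) => // [t _|].
  by rewrite mulr1 mul1r.
apply: (mxOZ (c := alpha)) (mxO_cst _ _) => //; first exact: ltW.
by move=> t t0; rewrite ger0_norm// mulr_ge0 ?expR_ge0// ltW.
Qed.

Variables (P : R -> 'M[R]_n) (theta_d : R -> 'cV[R]_n) (dtheta_d : R -> 'cV[R]_n) (rho : R).
Hypothesis rho_gt0 : 0 < rho.
Let rate t := expR (- rho * t).
Hypothesis P_decay : mxO [set t | 0 <= t] rate (fun t => P t - Phi).
Hypothesis theta_d_deriv : mx_deriv theta_d dtheta_d.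
Let W t := P t *m Q t *m P t + kappa *: (1%:M - P t) + prior t *: P t.
Hypothesis W_theta_d : forall t, 0 <= t -> W t *m theta_d t = P t *m varphi t.

Let rate_le1 t : 0 <= t -> rate t <= 1.
Proof.
by move=> t0; rewrite -expR0 ler_expR mulNr oppr_le0 mulr_ge0// ltW.
Qed.

Let gain_diff : mxO [set t | 0 <= t] rate (fun t => W t - Winf t).
Proof.
(* Since [Phi Q = Q = Q Phi], the difference [P Q P - Q] telescopes into terms with a factor
   [P - Phi]. *)
apply: (@mxO_eq _ _ _ _ _ (fun t => (P t - Phi) *m Q t *m P t + Q t *m (P t - Phi)
    + (prior t - kappa) *: (P t - Phi))).
  move=> t t0; rewrite mulmxBl mulmxBl mulmxBr QPhi// PhiQ// /W /Winf.
  move: (P t *m Q t *m P t) (Q t *m P t) => A B.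
  by apply/matrixP => i j; rewrite !mxE; ring.
have P_bounded : mxO1 [set t | 0 <= t] P.
  apply: (@mxO_eq _ _ _ _ _ (fun t => (P t - Phi) + Phi)); first by move=> t _; rewrite subrK.
  apply: mxOD; last exact: mxO_cst.
  by apply: mxO_rate P_decay; [exact: ler01|move=> t t0; rewrite mulr1 rate_le1].
apply: mxOD; first apply: mxOD.
- by apply: mxOMr => //; exact: mxOMr.
- exact: mxOMl.
apply: (@mxO1Z _ _ _ _ _ _ (alpha + kappa)) => // t t0.
rewrite (le_trans (ler_normB _ _))// lerD ?prior_le//.
by rewrite gtr0_norm.
Qed.

Lemma gain_coercive : exists c t1, [/\ 0 < c, 0 <= t1 & forall t, t1 <= t ->
  forall x : 'cV[R]_n, c * (x^T *m x) 0 0 <= (x^T *m W t *m x) 0 0].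
Proof.
have [c c0 hc] := limit_gain_coercive; have [C C0 hC] := gain_diff.
(* Chosen so that [n C = (c / 2) rho t1]; with [rho t <= e^(rho t)], the perturbation
   [n C e^(- rho t)] costs at most half of [c] from [t1] on. *)
pose t1 := 2 * (n%:R * C) / (c * rho).
have t10 : 0 <= t1 by rewrite divr_ge0 ?mulr_ge0// ?ltW.
exists (c / 2), t1; split => //; first by rewrite divr_gt0.
move=> t t1t x; have t0 := le_trans t10 t1t.
have -> : W t = Winf t + (W t - Winf t) by rewrite addrC subrK.
rewrite quadformD.
have := quadform_le x (hC t t0); rewrite ler_norml => /andP[hl _].
have hs := hc t t0 x; set s := (x^T *m x) 0 0 in hs hl *.
have s0 : 0 <= s := dotmx_ge0 x.
have small : n%:R * (C * rate t) <= c / 2.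
  have E0 : 0 < expR (rho * t) := expR_gt0 _.
  rewrite /rate mulNr expRN !mulrA ler_pdivrMr//.
  have h1 : rho * t <= expR (rho * t) by rewrite (le_trans _ (expR_ge1Dx _))// lerDr.
  have h2 : n%:R * C <= c / 2 * (rho * t).
    have -> : n%:R * C = c / 2 * (rho * t1) by rewrite /t1; field; rewrite !gt_eqF.
    by rewrite ler_wpM2l ?ler_pM2l// divr_ge0// ltW.
  by rewrite (le_trans h2)// ler_wpM2l// divr_ge0// ltW.
have := ler_wpM2r s0 small.
have -> : c / 2 * s = c * s - c / 2 * s by field.
move=> h3; apply: le_trans (lerD hs hl); rewrite lerD2l lerN2.
by have -> : c / 2 * s = c * s - c / 2 * s by field.
Qed.

Lemma theta_d_error : mxO [set t | 0 <= t] rate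
  (fun t => theta_d t - Phi *m theta_star t).
Proof.
have [c [t1 [c0 t10 hc]]] := gain_coercive.
have bstar : mxO1 [set t | 0 <= t] (fun t => Phi *m theta_star t).
  by apply: mxOMl; [exact: mxO_cst|exact: theta_star_bounded].
have late : mxO [set t | t1 <= t] rate (fun t => theta_d t - Phi *m theta_star t).
  apply: (coercive_mxO (A := W) (Y := fun t => (P t - Phi) *m varphi t
    - (W t - Winf t) *m (Phi *m theta_star t)) c0) => // [t t1t|].
    have t0 : 0 <= t := le_trans t10 t1t.
    have := limit_gain_Phi 0 t0; rewrite subr0 !mulmx0 scaler0 !subr0 => h.
    by rewrite mulmxBr W_theta_d// !mulmxBl h opprB addrA subrK.
  have late_sub : [set t | t1 <= t] `<=` [set t | 0 <= t] by move=> t; exact: le_trans.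
  apply: (mxO_sub late_sub); apply: mxOB; exact: mxOMr.
have early : mxO1 [set t | 0 <= t <= t1] (fun t => theta_d t - Phi *m theta_star t).
  apply: mxOB; first exact: mx_deriv_bounded theta_d_deriv.
  by apply: mxO_sub bstar => t /= /andP[].
have [C C0 hC] := late; have [C' C'0 hC'] := early.
(* Before [t1] the error is merely bounded by [C']; the factor [e^(rho t1)] compensates the rate
   there. *)
exists (C + C' * expR (rho * t1)); first by rewrite addr_ge0// mulr_ge0// expR_ge0.
move=> t t0 i j; have [tt1|/ltW t1t] := leP t t1.
  apply: (@le_trans _ _ C'); first by have := hC' t; rewrite /= t0 tt1 mulr1; apply.
  rewrite mulrDl; apply: ler_wpDl; first by rewrite mulr_ge0// expR_ge0.
  rewrite -mulrA ler_peMr// -expRD -expR0 ler_expR mulNr subr_ge0.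
  by rewrite ler_pM2l.
rewrite (le_trans (hC t t1t i j))// mulrDl lerDl.
by rewrite !mulr_ge0// expR_ge0.
Qed.

Lemma estimate_error : mxO [set t | 0 <= t] rate
  (fun t => theta_d t + (1%:M - P t) *m theta0 - theta_star t).
Proof.
apply: (@mxO_eq _ _ _ _ _ (fun t => (theta_d t - Phi *m theta_star t)
   - (P t - Phi) *m theta0)).
  move=> t t0; have := theta_star_unexcited t0; rewrite mulmxBr => /eqP.
  rewrite subr_eq => /eqP e; rewrite [in RHS]e !mulmxBl mul1mx.
  move: (Phi *m theta_star t) (Phi *m theta0) (P t *m theta0) => A B C.
  by apply/matrixP => i j; rewrite !mxE; ring.
apply: mxOB; first exact: theta_d_error.
by apply: mxOMr => //; exact: mxO_cst.
Qed.

End Convergence.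

(** * Assembly of the final estimates *)

Lemma cont0_eq (R : realType) (f g : R -> R) :
  (forall t, 0 <= t -> f t = g t) -> cont0 f -> cont0 g.
Proof.
move=> e /cont0P cf; apply/cont0P => t t0; rewrite -e//.
apply: cvg_trans (cf t t0); apply: near_eq_cvg.
by rewrite near_withinE; near=> s; rewrite /= in_itv/= andbT => /e ->.
Unshelve. all: by end_near.
Qed.

Lemma mxO_enorm (R : realType) n (D : set R) (r : R -> R) (v : R -> 'cV[R]_n) :
  (forall t, D t -> 0 <= r t) -> mxO D r v ->
  exists c, 0 < c /\ forall t, D t -> enorm (v t) <= c * r t.
Proof.
move=> r0 [C C0 hC]; exists (n%:R * C + 1); split.
  by rewrite ltr_wpDl// mulr_ge0.
move=> t Dt; apply: (@le_trans _ _ (n%:R * (C * r t))).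
  by apply: enorm_le => [|i]; [rewrite mulr_ge0// r0|exact: hC].
by rewrite mulrA ler_wpM2r ?r0// lerDl.
Qed.

Theorem theorem2 (R : realType) (n q : nat) (hq : (q <= n)%N)
  (phi : R -> 'cV[R]_n) (theta : 'cV[R]_n) (z eps : R -> R)
  (phi_smooth : smooth phi)
  (phi_bounded : exists M : R, forall t, 0 <= t -> enorm (phi t) <= M)
  (z_continuous : {within `[0, +oo[, continuous z})
  (eps_bounded : exists M : R, forall t, 0 <= t -> `|eps t| <= M)
  (model : forall t, 0 <= t -> z t = ((phi t)^T *m theta) 0 0 + eps t)
  (Phi : 'M[R]_n) (phi_PPE : PPE_with phi q Phi)
  (Nd : 'M[R]_(n, n - q)) (Nd_basis : orthonormal_basis Nd (image_mx Phi))
  (alpha beta delta kappa : R)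
  (alpha_gt0 : 0 < alpha) (beta_gt0 : 0 < beta)
  (delta_gt0 : 0 < delta) (kappa_gt0 : 0 < kappa)
  (theta0 : 'cV[R]_n)
  (theta_star : R -> 'cV[R]_n)
  (theta_star_min : forall t, 0 <= t ->
     is_minimizer (ls_cost phi z alpha beta theta0 t) (theta_star t)) :
  exists rho_b : R -> R,
    [/\ forall gamma, 0 < gamma -> 0 < rho_b gamma,
        rho_b gamma @[gamma --> +oo] --> +oo
      & forall (gamma : R) (theta_hat : R -> 'cV[R]_n),
          0 < gamma ->
          generated_estimate phi z alpha beta gamma delta kappa theta0
            theta_hat ->
          (exists rho_a : R, 0 < rho_a /\
             forall t, 0 <= t ->
               enorm (theta_hat t - theta_star t)
                 <= rho_a * expR (- rho_b gamma * t)) /\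
          ((forall t, 0 <= t -> eps t = 0) -> beta / 2 < gamma ->
           exists rho_c : R, 0 < rho_c /\
             forall t, 0 <= t ->
               enorm (Nd^T *m (theta_hat t - theta))
                 <= rho_c * expR (- (beta / 2) * t))].
Proof.
have phi_cont i j : cont0 (fun t => phi t i j).
  have [D [D0 dD]] := phi_smooth.
  have [h _] := is_derivative_mx_deriv (dD 0%N) i j.
  by apply: cont0_eq h => t t0; rewrite D0.
have bphi : mxO1 [set t | 0 <= t] phi.
  have [M hM] := phi_bounded; exists `|M| => // t t0 i j.
  by rewrite mulr1 ord1 (le_trans (normr_le_enorm _ _))// (le_trans (hM t t0))// ler_norm.
have z_bounded : exists M : R, forall t, 0 <= t -> `|z t| <= M.
  have [C C0 hC] : mxO1 [set t | 0 <= t] (fun t => (phi t)^T *m theta).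
    apply: mxOMl; last exact: mxO_cst.
    by have [C C0 h] := bphi; exists C => // t t0 i j; rewrite mxE h.
  have [M hM] := eps_bounded; exists (C + M) => t t0.
  rewrite model// (le_trans (ler_normD _ _))// lerD ?hM//.
  by have := hC t t0 0 0; rewrite mulr1.
have [Phi_proj _ [T [ka [kb [T0 ka0 _ Phi_PE]]]]] := phi_PPE.
(* Any rate strictly below [gamma] is available; half of it also tends to infinity. *)
exists (fun gamma => gamma / 2); split.
- by move=> gamma gamma0; rewrite divr_gt0.
- apply/cvgryPge => A; near=> gamma.
  by rewrite ler_pdivlMr//; near: gamma; apply: nbhs_pinfty_ge; exact: num_real.
move=> gamma theta_hat gamma0.
move=> [d [Nu [Q [P [dP [gain [varphi [theta_d [PE LA]]]]]]]]].
have Q0 := PEalg_Q0 PE; have dQ := is_derivative_mx_deriv (PEalg_Q PE).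
have dP_P := is_derivative_mx_deriv (PEalg_P PE).
have dvarphi := is_derivative_mx_deriv (learn_varphi LA).
have varphi0 := learn_varphi0 LA.
have Nu_le1 k i j : `|(Nu k *m (Nu k)^T) i j| <= 1.
  by apply: orthonormal_proj_le1; case: (PEalg_Nu PE k).
(* For such [k] the sampling time [k delta] is past [T], so the sampled kernel is that of [Phi]. *)
have Nu_limit k : ((Num.truncn (T / delta)).+1 <= k)%N ->
    Nu k *m (Nu k)^T = 1%:M - Phi.
  move=> hk; apply: kernel_basis_proj => //.
  have Tk : T <= k%:R * delta.
    rewrite -ler_pdivrMr//; apply: (@le_trans _ _ (Num.truncn (T / delta)).+1%:R).
      by apply/ltW; exact: truncnS_gt.
    by rewrite ler_nat.
  rewrite -(info_kernel beta_gt0 phi_cont Q0 dQ Phi_proj T0 ka0 Phi_PE Tk).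
  exact: PEalg_Nu PE k.
have P_decay := proj_filter_decay delta_gt0 gamma0 Nu_le1 dP_P (PEalg_dP PE) Nu_limit.
have dP_bounded := proj_filter_rate_bounded delta_gt0 gamma0 Nu_le1 dP_P (PEalg_dP PE).
have normal_eq t : 0 <= t ->
    Q t *m theta_star t + (alpha * expR (- beta * t)) *: theta_star t = varphi t.
  move=> t0; apply: (normal_equation alpha_gt0 phi_cont z_continuous
    Q0 dQ varphi0 dvarphi) => //.
  exact: theta_star_min.
have W_theta_d := gain_inverse_theta_d kappa_gt0 phi_cont dQ dvarphi (PEalg_P0 PE)
  dP_P dP_bounded (learn_theta_d0 LA) (is_derivative_mx_deriv (learn_theta_d LA))
  (learn_Omega0 LA) (is_derivative_mx_deriv (learn_Omega LA)).
(* The rate stays free: it is [gamma / 2] for the first claim and [beta / 2] for the noise-free one,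
   where [beta / 2 < gamma] is assumed. *)
have error rho : 0 < rho -> rho < gamma ->
    mxO [set t | 0 <= t] (fun t => expR (- rho * t)) (fun t => theta_hat t - theta_star t).
  move=> rho0 rhog.
  apply: mxO_eq (estimate_error alpha_gt0 beta_gt0 kappa_gt0 phi_cont bphi z_bounded
    Q0 dQ varphi0 dvarphi Phi_proj T0 ka0 Phi_PE normal_eq rho0 (P_decay rho rhog)
    (is_derivative_mx_deriv (learn_theta_d LA)) W_theta_d) => t t0.
  by rewrite (learn_theta_hat LA).
split.
  apply: mxO_enorm => [t _|]; first exact: expR_ge0.
  by apply: error; [exact: divr_gt0|rewrite gtr_pMr// invf_lt1// ltr1n].
move=> eps0 bg.
have noise_free := theta_star_noise_free alpha_gt0 beta_gt0 kappa_gt0 phi_cont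
  Q0 dQ varphi0 dvarphi Phi_proj T0 ka0 Phi_PE normal_eq.
have b2 : 0 < beta / 2 by rewrite divr_gt0.
apply: mxO_enorm => [t _|]; first exact: expR_ge0.
(* Split at [theta_star], inserting [Phi] by [Nd^T Phi = Nd^T]. The second summand decays like
   [e^(- beta t)], faster than required. *)
apply: (@mxO_eq _ _ _ _ _ (fun t => Nd^T *m (theta_hat t - theta_star t)
    + Nd^T *m (Phi *m (theta_star t - theta)))).
  move=> t _; rewrite [Nd^T *m (Phi *m _)]mulmxA (image_basis_proj Phi_proj Nd_basis).
  by rewrite -mulmxDr addrA subrK.
apply: mxOD; apply: mxOMl; [exact: mxO_cst|exact: error|exact: mxO_cst|].
apply: mxO_rate (noise_free theta _); [exact: ler01| |].
  move=> t t0; rewrite mul1r ler_expR !mulNr lerN2 ler_wpM2r//.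
  by rewrite ler_piMr ?(ltW beta_gt0)// invf_le1// ler1n.
by move=> t t0; rewrite model// eps0// addr0.
Unshelve. all: by end_near.
Qed.
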